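(* Each of the following holds. 1. For all sufficiently large $n$ there are a balanced Boolean function $f_n:\{-1,1\}^n\to\{-1,1\}$ and a randomized algorithm $A_n$ that always (with probability $1$, on every input) correctly evaluates $f_n$, such that $\delta(A_n)=\Theta(n^{-1/2}\sqrt{\log n})$ as $n\to\infty$. 2. For every fixed $\varepsilon>0$ and all sufficiently large $n$ there are a balanced Boolean function $f_n:\{-1,1\}^n\to\{-1,1\}$ and a randomized algorithm $A_n$ that correctly evaluates $f_n$ on most inputs most of the time (with tolerance $\varepsilon$), such that $\delta(A_n)=\Theta(n^{-1/2})$ as $n\to\infty$, where the implied constants may depend on $\varepsilon$. 3. For all sufficiently large $n$ there are a balanced monotone Boolean function $f_n:\{-1,1\}^n\to\{-1,1\}$ and a randomized algorithm $A_n$ that always (with probability $1$, on every input) correctly evaluates $f_n$, such that $\delta(A_n)=\Theta(n^{-1/3}\log n)$ as $n\to\infty$. 4. For every fixed $\varepsilon>0$ and all sufficiently large $n$ there are a balanced monotone Boolean function $f_n:\{-1,1\}^n\to\{-1,1\}$ and a randomized algorithm $A_n$ that correctly evaluates $f_n$ on most inputs most of the time (with tolerance $\varepsilon$), such that $\delta(A_n)=\Theta(n^{-1/3})$ as $n\to\infty$, where the implied constants may depend on $\varepsilon$.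
   Context: A Boolean function of $n$ bits is a function $f:\{-1,1\}^n\to\{-1,1\}$. It is balanced if $\Pr[f(x)=1]=1/2$ for uniformly random $x\in\{-1,1\}^n$. It is monotone if $f(x)\ge f(y)$ whenever $x_i\ge y_i$ for all $i=1,\dots,n$. A randomized algorithm on $n$ input bits is a randomized adaptive query procedure (a probability distribution over deterministic decision trees): using random coins $r$ independent of the input, it reads input bits one at a time, each choice of the next bit to read (or the decision to stop and output a value in $\{-1,1\}$) depending only on the coins and on the values of the bits read so far. Write $A(r,x)$ for its output on input $x$ with coins $r$. For a randomized algorithm $A$, let $\delta_i=\Pr[\text{bit } i \text{ gets read}]$, where the probability is over a uniformly random input $x\in\{-1,1\}^n$ and the independent internal coins of $A$, and let $\delta(A)=\max_{1\le i\le n}\delta_i$. $A$ correctly evaluates $f$ on most inputs most of the time (with tolerance $\varepsilon$) if for at least a fraction $1-\varepsilon$ of the inputs $x\in\{-1,1\}^n$ one has $\Pr_r[A(r,x)=f(x)]\ge 1-\varepsilon$. $a_n=\Theta(b_n)$ means that there are constants $0<c\le C<\infty$ with $c\,b_n\le a_n\le C\,b_n$ for all sufficiently large $n$. *)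

(* Defs.v *)
From HB Require Import structures.
From mathcomp Require Import all_boot all_order all_algebra.
From mathcomp Require Import all_classical all_reals all_analysis.

Set Implicit Arguments.
Unset Strict Implicit.
Unset Printing Implicit Defensive.

Import Order.TTheory GRing.Theory Num.Theory.
Import numFieldNormedType.Exports.

Local Open Scope classical_set_scope.
Local Open Scope ring_scope.

(* The two-element set {-1, 1} is encoded by bool: true is 1, false is -1. *)
Definition cube (n : nat) := {ffun 'I_n -> bool}.

Definition boolean_function (n : nat) := cube n -> bool.

Definition cube_prob (F : numFieldType) (n : nat) (E : {set cube n}) : F :=
  #|E|%:R / (2 ^ n)%:R.

Definition cube_mean (F : numFieldType) (n : nat) (g : cube n -> F) : F :=
  (\sum_(x : cube n) g x) / (2 ^ n)%:R.

Definition balanced (n : nat) (f : boolean_function n) : Prop :=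
  cube_prob rat [set x | f x] = 2^-1.

(* [y i ==> x i] is y_i <= x_i. *)
Definition monotone_function (n : nat) (f : boolean_function n) : Prop :=
  forall x y : cube n, (forall i, y i ==> x i) -> f y ==> f x.

Inductive decision_tree (n : nat) : Type :=
| Output of bool
| Query (i : 'I_n) (if_minus if_plus : decision_tree n).

Arguments Output {n}.

Fixpoint tree_eval (n : nat) (t : decision_tree n) (x : cube n) : bool :=
  match t with
  | Output b => b
  | Query i t0 t1 => if x i then tree_eval t1 x else tree_eval t0 x
  end.

Fixpoint tree_reads (n : nat) (t : decision_tree n) (x : cube n) (i : 'I_n) : bool :=
  match t with
  | Output _ => false
  | Query j t0 t1 => (i == j) || (if x j then tree_reads t1 x i else tree_reads t0 x i)
  end.

(* Decision trees form a countable type, so the discrete sigma-algebra is the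
   natural one. *)
HB.instance Definition _ (n : nat) := gen_eqMixin (decision_tree n).
HB.instance Definition _ (n : nat) := gen_choiceMixin (decision_tree n).
HB.instance Definition _ (n : nat) :=
  isPointed.Build (decision_tree n) (Output true).
HB.instance Definition _ (n : nat) :=
  @isMeasurable.Build default_measure_display (decision_tree n)
    discrete_measurable discrete_measurable0
    discrete_measurableC discrete_measurableU.

(* The coins are the random choice of the tree itself; their law does not
   depend on the input. *)
Definition randomized_algorithm (R : realType) (n : nat) :=
  probability (decision_tree n) R.

Section Algorithms.
Context (R : realType) (n : nat).
Implicit Types (A : randomized_algorithm R n) (f : boolean_function n).

Definition prob_correct A f (x : cube n) : R :=
  fine (A [set t | tree_eval t x = f x]).

(* Uniform input independent of the coins: by Fubini, the joint probability is
   the mean over x of the probability over the coins. *)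
Definition read_prob A (i : 'I_n) : R :=
  cube_mean (fun x => fine (A [set t | tree_reads t x i])).

Definition max_read_prob A : R := \big[Num.max/0]_(i < n) read_prob A i.

Definition always_correct A f : Prop := forall x, prob_correct A f x = 1.

Definition mostly_correct (eps : R) A f : Prop :=
  1 - eps <= cube_prob R [set x | 1 - eps <= prob_correct A f x].

End Algorithms.

(* Main.v *)
Require Import Defs.
From HB Require Import structures.
From mathcomp Require Import all_boot all_order all_algebra.
From mathcomp Require Import all_classical all_reals all_analysis.
From mathcomp Require Import ring lra zify.

Set Implicit Arguments.
Unset Strict Implicit.
Unset Printing Implicit Defensive.

Import Order.TTheory GRing.Theory Num.Theory.
Import numFieldNormedType.Exports.

Local Open Scope ring_scope.

(** Since the functions and the algorithms are both to be chosen, only upper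
    bounds need an idea: every algorithm below surely reads a bit in some layer
    of [w] bits, so that some bit is read with probability at least [1 / w], and
    the width [w] is then adjusted to be the inverse of the target rate.

    The input bits are the vertices of a layered graph, with layers indexed by
    time and [w] vertices in each of them, identified with the integers modulo
    [w].  A walk which is at vertex [v] at time [t] reads the bit of [v] in layer
    [t], and moves to [v + s t] if this bit is [true], and to [v] otherwise
    ([move], [pos]).  Two walks that meet coalesce.  Everything is invariant under
    rotations of the layers, so a walk started from a uniform vertex reads each
    bit with probability at most [1 / w], and the set of vertices visited at a
    given time contains each vertex with probability its mean size divided by
    [w] ([avg_equivariant], [avg_visits]).

    Without monotonicity, the function is the bit at the end, in the last layer
    [h], of the walk that starts at vertex 0 of layer 0; this bit is fresh, so the
    function is balanced.  If all walks coalesce before time [h], then every walk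
    finds this bit.  The shifts [s t] are chosen by averaging over uniform
    independent shifts: when [N] vertices are occupied, each of the [N (N - 1)]
    ordered pairs of distinct vertices merges with probability [1 / (4 w)]
    ([mean_imageS]), so that the mean of [N - 1] after [k] steps is at most
    [4 w / k], and halves every [2 w] steps.  With [h] a large multiple of [w],
    hence [n] of order [w ^ 2], one walk from a random vertex gives the answer
    with a small probability of error ([single_walk_algorithm]).

    For an exact answer, the algorithm starts at a random time [T], follows the
    walks from all the vertices of layer [T], and reads everything if they have
    not merged at time [h].  With [h] of order [w log w] this last event has
    probability [O(1 / w)], and the total number of vertices visited is
    [O(w log w)] on average, that is [O(1)] per layer.  This is an average over
    layers whereas each layer must be controlled; it is enough to start only in
    the layers where the sum is not much larger than its average
    ([column_sum_le], [multi_walk_algorithm]).  Here [n] has order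
    [w ^ 2 log w], whence the rate [sqrt (log n / n)].

    In the monotone case all shifts are 1 and the number of layers is
    [h = w (2 m + 1)].  Walks lifted to the universal cover of the circle are
    monotone in the starting point and in the bits ([lift_mono]), so that the
    event that some walk advances by at least [w (m + 1)] is increasing, and it is
    disjoint from the decreasing event that some walk advances by at most [w m].
    Reflecting the circle and negating the bits exchanges the two, and this gives
    a balanced monotone function once the remaining inputs are shared out
    ([winding_bit]).  If a walk returns after [h] steps to its starting vertex, then
    its number of turns determines the value ([winding_bit_fixpoint]).  If all walks
    have coalesced, then the walk restarted from the end of any walk is such a walk,
    so two rounds suffice.  For the displacement [d] of two walks, [d (w - d)]
    decreases by [1 / 2] on average in each step before they meet ([avg_gapS]);
    hence the walks coalesce in order [w ^ 2] steps, and [n] has order [w ^ 3], with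
    a logarithmic factor when the failure probability must be [O(1 / w)]. *)

(** * Finite mixtures of decision trees *)

(** The last argument of [mnormalize] is the value at the empty list of trees. *)
Definition uniform_algorithm (R : realType) n (ts : seq (decision_tree n)) :
    randomized_algorithm R n :=
  mnormalize (msum (fun k => dirac (nth (Output true) ts k)) (size ts))
             (dirac (Output true)).

Lemma uniform_algorithmE (R : realType) n (ts : seq (decision_tree n))
    (p : pred (decision_tree n)) :
  ts != [::] ->
  fine (uniform_algorithm R ts [set t | p t]%classic) =
  (count p ts)%:R / (size ts)%:R.
Proof.
move=> ts0.
have msumE (q : pred (decision_tree n)) :
    msum (fun k => dirac (nth (Output true) ts k)) (size ts) [set t | q t]%classic = ((count q ts)%:R : R)%:E.
  rewrite /msum /=.
  under eq_bigr => k _ do rewrite diracE.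
  rewrite sumEFin -sum1_count natr_sum; congr (_%:E).
  rewrite [RHS]big_mkcond /= (big_nth (Output true)) big_mkord.
  apply: eq_bigr => k _.
  by case: ifPn => h; [rewrite mem_set | rewrite memNset //=; exact/negP].
rewrite /uniform_algorithm /= /mnormalize /=.
have -> : [set: decision_tree n]%classic = [set t | predT t]%classic.
  by apply/seteqP; split.
rewrite msumE count_predT eqe pnatr_eq0 size_eq0 (negPf ts0) /=.
by rewrite msumE.
Qed.

Section UniformAlgorithm.
Context (R : realType) (n : nat) (J : finType) (A : {set J}).
Variable (tau : J -> decision_tree n).
Hypothesis A0 : (0 < #|A|)%N.

Let alg := uniform_algorithm R [seq tau j | j <- enum A].

Let algE (p : pred (decision_tree n)) : fine (alg [set t | p t]%classic) =
  (\sum_(j in A) (p (tau j))%:R) / #|A|%:R.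
Proof.
rewrite uniform_algorithmE; last by rewrite -size_eq0 size_map -cardE -lt0n.
rewrite size_map -cardE -sum1_count big_map big_mkcond /= natr_sum.
by rewrite big_enum /=; congr (_ / _); apply: eq_bigr => j _; case: (p _).
Qed.

Lemma prob_correct_uniform f x :
  prob_correct alg f x = (\sum_(j in A) (tree_eval (tau j) x == f x)%:R) / #|A|%:R.
Proof.
rewrite /prob_correct -(algE (fun t => tree_eval t x == f x)).
by congr (fine (alg _)); apply/seteqP; split => t /= /eqP.
Qed.

Lemma prob_correct_eq1 f x :
  (forall j, j \in A -> tree_eval (tau j) x = f x) -> prob_correct alg f x = 1.
Proof.
move=> h; rewrite prob_correct_uniform.
under eq_bigr => j jA do rewrite h // eqxx.
by rewrite sumr_const divff // pnatr_eq0 -lt0n.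
Qed.

Lemma read_prob_uniform i :
  read_prob alg i =
  (\sum_(j in A) cube_mean (fun x => (tree_reads (tau j) x i)%:R)) / #|A|%:R.
Proof.
rewrite /read_prob /cube_mean.
under eq_bigr => x _ do rewrite (algE (fun t => tree_reads t x i)).
by rewrite -!mulr_suml exchange_big /= mulrAC.
Qed.

End UniformAlgorithm.

(** * Bits and queries addressed by natural numbers *)

(** Positions beyond the last one carry the constant [false], so that bits and
    queries can be addressed by arithmetic expressions without bound proofs. *)
Definition bit n (x : cube n) (k : nat) : bool := oapp x false (insub k).

Lemma bit_ord n (x : cube n) (i : 'I_n) : bit x i = x i.
Proof. by rewrite /bit valK. Qed.

Lemma bit_large n (x : cube n) k : (n <= k)%N -> bit x k = false.
Proof. by move=> nk; rewrite /bit insubF // ltnNge nk. Qed.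

Definition query_bit n (k : nat) (t0 t1 : decision_tree n) : decision_tree n :=
  if insub k is Some i then Query i t0 t1 else t0.

Lemma tree_eval_query_bit n k (t0 t1 : decision_tree n) x :
  tree_eval (query_bit k t0 t1) x = tree_eval (if bit x k then t1 else t0) x.
Proof. by rewrite /query_bit /bit; case: insub => //= i; case: (x i). Qed.

Lemma tree_reads_query_bit n k (t0 t1 : decision_tree n) x i :
  tree_reads (query_bit k t0 t1) x i =
  ((i : nat) == k) || tree_reads (if bit x k then t1 else t0) x i.
Proof.
rewrite /query_bit /bit; case: insubP => [j _ <- /=|nk /=]; first by case: (x j).
by case: eqP => // ik; rewrite -ik ltn_ord in nk.
Qed.

(** Continuation-passing style: the bits in [ks] are read and recorded in [y],
    and the rest of the tree is chosen by [K] from the record. *)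
Fixpoint ask n (ks : seq nat) (y : nat -> bool)
    (K : (nat -> bool) -> decision_tree n) : decision_tree n :=
  if ks is k :: ks' then
    query_bit k (ask ks' (fun j => if j == k then false else y j) K)
                (ask ks' (fun j => if j == k then true else y j) K)
  else K y.

Definition inspect n ks (K : (nat -> bool) -> decision_tree n) :=
  ask ks (fun=> false) K.

Definition seen n (ks : seq nat) (x : cube n) : nat -> bool :=
  fun k => (k \in ks) && bit x k.

Definition recorded n (ks : seq nat) (x : cube n) (y : nat -> bool) :=
  fun k => if k \in ks then bit x k else y k.

Lemma recorded_cons n k ks (x : cube n) y :
  recorded (k :: ks) x y =
  recorded ks x (fun j => if j == k then bit x k else y j).
Proof.
apply/funext => j; rewrite /recorded inE.
by case: eqP => [->|] //=; case: ifP.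
Qed.

Lemma seenE n ks (x : cube n) : seen ks x = recorded ks x (fun=> false).
Proof. by apply/funext => k; rewrite /seen /recorded; case: ifP. Qed.

Lemma seen_all n (x : cube n) : seen (iota 0 n) x = bit x.
Proof.
apply/funext => k; rewrite /seen mem_iota add0n /=.
by case: ltnP => // nk; rewrite bit_large.
Qed.

Lemma tree_eval_inspect n ks (K : (nat -> bool) -> decision_tree n) x :
  tree_eval (inspect ks K) x = tree_eval (K (seen ks x)) x.
Proof.
rewrite /inspect seenE; move: (fun=> false).
elim: ks => [|k ks IH] y //=.
by rewrite tree_eval_query_bit recorded_cons -IH; case: (bit x k).
Qed.

Lemma tree_reads_inspect n ks (K : (nat -> bool) -> decision_tree n) x i :
  tree_reads (inspect ks K) x i =
  ((i : nat) \in ks) || tree_reads (K (seen ks x)) x i.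
Proof.
rewrite /inspect seenE; move: (fun=> false).
elim: ks => [|k ks IH] y //=.
rewrite tree_reads_query_bit recorded_cons inE -orbA.
by case: (bit x k); rewrite IH.
Qed.

(** * Averages over finite types *)

Lemma card_cube n : #|{: cube n}| = (2 ^ n)%N.
Proof. by rewrite card_ffun card_bool card_ord. Qed.

Definition avg (R : numFieldType) (I : finType) (g : I -> R) : R :=
  (\sum_i g i) / #|I|%:R.

Section Average.
Context (R : realFieldType) (I : finType).
Implicit Types (g : I -> R).

Lemma avgD g1 g2 : avg (fun x => g1 x + g2 x) = avg g1 + avg g2.
Proof. by rewrite /avg big_split mulrDl. Qed.

Lemma avgB g1 g2 : avg (fun x => g1 x - g2 x) = avg g1 - avg g2.
Proof. by rewrite /avg sumrB mulrBl. Qed.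

Lemma avgZ c g : avg (fun x => c * g x) = c * avg g.
Proof. by rewrite /avg -mulr_sumr mulrA. Qed.

Lemma avg_sum (J : Type) (r : seq J) (P : pred J) (G : J -> I -> R) :
  avg (fun x => \sum_(j <- r | P j) G j x) = \sum_(j <- r | P j) avg (G j).
Proof. by rewrite /avg exchange_big /= mulr_suml. Qed.

Lemma le_avg g1 g2 : (forall x, g1 x <= g2 x) -> avg g1 <= avg g2.
Proof. by move=> h; rewrite ler_wpM2r ?invr_ge0 ?ler0n // ler_sum. Qed.

Lemma eq_avg g1 g2 : g1 =1 g2 -> avg g1 = avg g2.
Proof. by move=> h; congr (_ / _); apply: eq_bigr. Qed.

Lemma avg_reindex (h : I -> I) g : injective h -> avg (fun x => g (h x)) = avg g.
Proof. by move=> hI; rewrite /avg [in RHS](reindex_inj hI). Qed.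

Lemma avg_ge0 g : (forall x, 0 <= g x) -> 0 <= avg g.
Proof. by move=> h; rewrite divr_ge0 ?ler0n ?sumr_ge0. Qed.

Hypothesis I0 : (0 < #|I|)%N.

Lemma avg_cst (c : R) : avg (fun _ : I => c) = c.
Proof.
by rewrite /avg sumr_const -[c *+ _]mulr_natr mulfK // pnatr_eq0 -lt0n.
Qed.

Lemma exists_le_avg g c : avg g <= c -> exists x, g x <= c.
Proof.
move=> gc; case: (pselect (exists x, g x <= c)) => // h.
have hx x : c < g x by rewrite ltNge; apply/negP => gx; apply: h; exists x.
have /card_gt0P[x0 _] := I0.
suff : c < avg g by rewrite ltNge gc.
rewrite -[ltLHS]avg_cst ltr_pM2r ?invr_gt0 ?ltr0n //.
by apply: ltr_sum => //; apply/hasP; exists x0; rewrite ?mem_index_enum.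
Qed.

Lemma sqr_avg_le g : avg g ^+ 2 <= avg (fun x => g x ^+ 2).
Proof.
have := avg_ge0 (fun x => sqr_ge0 (g x - avg g)).
have e x : (g x - avg g) ^+ 2 = g x ^+ 2 - 2 * avg g * g x + avg g ^+ 2.
  by ring.
rewrite (eq_avg e) avgD avgB avg_cst avgZ; nra.
Qed.

End Average.

Lemma cube_meanE (R : realFieldType) n (g : cube n -> R) : cube_mean g = avg g.
Proof. by rewrite /cube_mean /avg card_cube. Qed.

Lemma cube_gt0 n : (0 < #|{: cube n}|)%N.
Proof. by rewrite card_cube expn_gt0. Qed.

Lemma cube_probE (R : realFieldType) n (p : pred (cube n)) :
  cube_prob R [set x | p x] = avg (fun x => (p x)%:R).
Proof.
rewrite /cube_prob /avg card_cube -sum1_card natr_sum big_mkcond /=.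
by congr (_ / _); apply: eq_bigr => x _; rewrite inE; case: (p x).
Qed.

Lemma balanced_of_antisymmetry n (f : boolean_function n) (h : cube n -> cube n) :
  injective h -> (forall x, f (h x) = ~~ f x) -> balanced f.
Proof.
move=> hI hf; rewrite /balanced /cube_prob.
have hC : #|[set x | f x]| = #|[set x | ~~ f x]|.
  rewrite -[LHS]sum1_card -[RHS]sum1_card (reindex_inj hI) /=.
  by apply: eq_bigl => x; rewrite !inE hf.
have := cardsC [set x | f x]; rewrite card_cube.
have -> : ~: [set x | f x] = [set x | ~~ f x] by apply/setP => x; rewrite !inE.
rewrite -hC addnn -mul2n => e.
have N0 : (2 ^ n)%:R != 0 :> rat by rewrite pnatr_eq0 expn_eq0.
by apply: (mulIf N0); rewrite divfK // -e natrM mulKf.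
Qed.

(** * Measure-preserving transformations of the cube *)

Definition flip n (k : nat) (x : cube n) : cube n :=
  [ffun i : 'I_n => ((i : nat) == k) (+) x i].

Lemma bit_flip n k (x : cube n) j :
  (k < n)%N -> bit (flip k x) j = (j == k) (+) bit x j.
Proof.
move=> kn; case: (ltnP j n) => jn.
  by have := bit_ord (flip k x) (Ordinal jn); rewrite ffunE -bit_ord.
by rewrite !bit_large //; case: eqP => // jk; rewrite leqNgt jk kn in jn.
Qed.

(** Flipping a bit whose position depends on the input is still a bijection,
    provided that the flip does not move the position: this is how the freshly
    read bit is seen to be uniform given the past of the walk. *)
Lemma flip_at_involutive n (a : cube n -> nat) :
  (forall x, a (flip (a x) x) = a x) -> involutive (fun x => flip (a x) x).
Proof.
move=> ha x; apply/ffunP => i; rewrite ha !ffunE.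
by case: (_ == _) => //=; case: (x i).
Qed.

Section Layers.
Context (w' : nat).
Let w := w'.+1.
Local Notation V := 'I_w'.+1.

Definition vtx (t : nat) (v : V) : nat := (t * w + v)%N.

Lemma vtx_div t v : (vtx t v %/ w = t)%N.
Proof. by rewrite /vtx divnMDl // divn_small ?addn0. Qed.

Lemma vtx_mod t v : (vtx t v %% w = v)%N.
Proof. by rewrite /vtx modnMDl modn_small. Qed.

Lemma vtx_inj t u t' v : vtx t u = vtx t' v -> t = t' /\ u = v.
Proof.
move=> e; split; first by rewrite -(vtx_div t u) e vtx_div.
by apply: val_inj; rewrite /= -(vtx_mod t u) e vtx_mod.
Qed.

Lemma vtx_eq t u t' v : (vtx t u == vtx t' v) = (t == t') && (u == v).
Proof.
apply/eqP/andP => [/vtx_inj[-> ->]|[/eqP-> /eqP->]] //.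
Qed.

Lemma vtx_lt t v h : (t < h)%N -> (vtx t v < h * w)%N.
Proof.
move=> th; apply: leq_trans (leq_mul th (leqnn w)).
by rewrite mulSn /vtx -addnS addnC leq_add2r.
Qed.

Definition relabel n (h : nat) (phi : nat -> V -> V) (c : bool) (x : cube n) :
    cube n :=
  [ffun i : 'I_n => c (+)
     if (i < h * w)%N then bit x (vtx (i %/ w) (phi (i %/ w)%N (inord (i %% w))))
     else x i].

Lemma bit_relabel n h phi c (x : cube n) t v : (h * w <= n)%N -> (t < h)%N ->
  bit (relabel h phi c x) (vtx t v) = c (+) bit x (vtx t (phi t v)).
Proof.
move=> hn th; have vn := leq_trans (vtx_lt v th) hn.
have := bit_ord (relabel h phi c x) (Ordinal vn); rewrite ffunE /= => ->.
by rewrite vtx_lt // vtx_div vtx_mod inord_val.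
Qed.

Lemma relabel_inj n h phi c : (h * w <= n)%N -> (forall t, injective (phi t)) ->
  injective (@relabel n h phi c).
Proof.
move=> hn phiI x y exy; apply/ffunP => i.
have [ih|ih] := ltnP i (h * w); last first.
  have := congr1 (fun z : cube n => z i) exy; rewrite !ffunE ltnNge ih /=.
  exact: addbI.
have th : (i %/ w < h)%N by rewrite ltn_divLR.
have iE : (i : nat) = vtx (i %/ w) (inord (i %% w)).
  by rewrite /vtx inordK ?ltn_pmod // -divn_eq.
set v := inord _ in iE.
have [u uv] : exists u, phi (i %/ w)%N u = v.
  by exists (invF (phiI (i %/ w)%N) v); rewrite f_invF.
have := congr1 (fun z => bit z (vtx (i %/ w) u)) exy.
rewrite /= !bit_relabel // uv -iE !bit_ord; exact: addbI.
Qed.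

End Layers.

(** * Coalescing walks *)

Section Walks.
Context (w' : nat).
Let w := w'.+1.
Local Notation V := 'I_w'.+1.
Implicit Types (s : nat -> V) (y : nat -> bool) (v : V) (S : {set V}).

Definition move s y t v : V := if y (vtx t v) then v + s t else v.

Definition pos s y T k v : V := iteri k (fun r u => move s y (T + r) u) v.

Definition ones s y T k v : nat :=
  \sum_(r < k) y (vtx (T + r) (pos s y T r v)).

Lemma posS s y T k v : pos s y T k.+1 v = move s y (T + k) (pos s y T k v).
Proof. by []. Qed.

Lemma pos_add s y T j k v :
  pos s y T (j + k) v = pos s y (T + j) k (pos s y T j v).
Proof. by elim: k => [|k IH]; rewrite ?addn0 // addnS !posS IH addnA. Qed.

Lemma pos_first s y T k v : pos s y T k.+1 v = pos s y T.+1 k (move s y T v).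
Proof. by rewrite -[k.+1]add1n pos_add addn1 posS addn0. Qed.

Lemma ones_first s y T k v :
  ones s y T k.+1 v = (y (vtx T v) + ones s y T.+1 k (move s y T v))%N.
Proof.
rewrite /ones big_ord_recl addn0; congr addn; apply: eq_bigr => r _.
by rewrite lift0 pos_first addSnnS.
Qed.

Lemma eq_pos s s' y y' T k v :
  (forall r, (r < k)%N -> s (T + r)%N = s' (T + r)%N) ->
  (forall r (u : V), (r < k)%N -> y (vtx (T + r) u) = y' (vtx (T + r) u)) ->
  pos s y T k v = pos s' y' T k v.
Proof.
elim: k => [//|k IH] hs hy; rewrite !posS /move IH.
- by rewrite hs // hy.
- by move=> r rk; apply: hs; apply: ltnW.
- by move=> r u rk; apply: hy; apply: ltnW.
Qed.

(** The bit read at time [T + k] does not influence the walk up to that time. *)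
Lemma pos_flip s n (x : cube n) T k t (u v : V) : (vtx t u < n)%N -> (T + k <= t)%N ->
  pos s (bit (flip (vtx t u) x)) T k v = pos s (bit x) T k v.
Proof.
move=> un Tkt; apply: eq_pos => // r a rk.
rewrite bit_flip // vtx_eq; case: eqP => [e|] //=.
by move: Tkt; rewrite -e leq_add2l leqNgt rk.
Qed.

Lemma eq_move_in s y y' t S :
  (forall v : V, v \in S -> y (vtx t v) = y' (vtx t v)) ->
  move s y t @: S = move s y' t @: S.
Proof. by move=> h; apply: eq_in_imset => v vS; rewrite /move h. Qed.

(** ** Following a walk, or the image of a set of starting points *)

Fixpoint follow n s k t v c (K : V -> nat -> decision_tree n) : decision_tree n :=
  if k is k'.+1 then
    query_bit (vtx t v) (follow s k' t.+1 v c K)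
                        (follow s k' t.+1 (v + s t) c.+1 K)
  else K v c.

Lemma tree_eval_follow n s k t v c (K : V -> nat -> decision_tree n) x :
  tree_eval (follow s k t v c K) x =
  tree_eval (K (pos s (bit x) t k v) (c + ones s (bit x) t k v)%N) x.
Proof.
elim: k t v c => [|k IH] t v c; first by rewrite /ones big_ord0 addn0.
rewrite tree_eval_query_bit pos_first ones_first /move.
by case: (bit x _); rewrite IH ?addnA ?addn1 ?addn0.
Qed.

Lemma tree_reads_follow n s k t v c (K : V -> nat -> decision_tree n) x i :
  tree_reads (follow s k t v c K) x i =
  [exists r : 'I_k, (i : nat) == vtx (t + r) (pos s (bit x) t r v)] ||
  tree_reads (K (pos s (bit x) t k v) (c + ones s (bit x) t k v)%N) x i.
Proof.
elim: k t v c => [|k IH] t v c.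
  rewrite /ones big_ord0 addn0.
  by case: existsP => // -[[]].
rewrite tree_reads_query_bit pos_first ones_first.
set F := fun r => (i : nat) == vtx (t + r) (pos s (bit x) t r v).
have -> : [exists r : 'I_k.+1, F r] = F 0%N || [exists r : 'I_k, F r.+1].
  apply/existsP/orP => [[[[|r] rk] h]|[h|/existsP[r h]]].
  - by left.
  - by right; apply/existsP; exists (Ordinal (rk : (r < k)%N)).
  - by exists ord0.
  - by exists (lift ord0 r).
have -> : [exists r : 'I_k, F r.+1] = [exists r : 'I_k,
    (i : nat) == vtx (t.+1 + r) (pos s (bit x) t.+1 r (move s (bit x) t v))].
  by apply: eq_existsb => r; rewrite /F addSnnS pos_first.
rewrite /F /= addn0 -orbA; congr (_ || _).
by rewrite /move; case: (bit x _); rewrite IH ?addnA ?addn1 ?addn0.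
Qed.

Fixpoint track n s k t S (K : {set V} -> decision_tree n) : decision_tree n :=
  if k is k'.+1 then
    inspect [seq vtx t v | v <- enum S]
      (fun y => track s k' t.+1 (move s y t @: S) K)
  else K S.

Lemma move_seen n s (x : cube n) t S :
  move s (seen [seq vtx t v | v <- enum S] x) t @: S = move s (bit x) t @: S.
Proof.
apply: eq_move_in => v vS; rewrite /seen.
by rewrite map_f // mem_enum.
Qed.

Lemma pos_imset_first s y T k S :
  pos s y T k.+1 @: S = pos s y T.+1 k @: (move s y T @: S).
Proof. by rewrite -imset_comp; apply: eq_imset => v; rewrite pos_first. Qed.

Lemma tree_eval_track n s k t S (K : {set V} -> decision_tree n) x :
  tree_eval (track s k t S K) x = tree_eval (K (pos s (bit x) t k @: S)) x.
Proof.
elim: k t S => [|k IH] t S /=; first by rewrite imset_id.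
by rewrite tree_eval_inspect move_seen IH pos_imset_first.
Qed.

Lemma tree_reads_track n s k t S (K : {set V} -> decision_tree n) x i :
  tree_reads (track s k t S K) x i =
  [exists r : 'I_k, exists v in pos s (bit x) t r @: S, (i : nat) == vtx (t + r) v]
  || tree_reads (K (pos s (bit x) t k @: S)) x i.
Proof.
elim: k t S => [|k IH] t S /=.
  by rewrite imset_id; case: existsP => // -[[]].
rewrite tree_reads_inspect move_seen IH pos_imset_first orbA; congr (_ || _).
apply/orP/existsP => [[/mapP[v vS ->]|/existsP[r /exists_inP[v vS /eqP->]]]|].
- exists ord0; apply/exists_inP; exists v; rewrite ?addn0 //.
  by apply/imsetP; exists v => //; rewrite mem_enum in vS.
- exists (lift ord0 r); apply/exists_inP; exists v.
    by rewrite pos_imset_first.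
  by rewrite lift0 addSnnS.
move=> [[[|r] rk] /exists_inP[v]] /=.
  by rewrite imset_id addn0 => vS /eqP->; left; rewrite map_f // mem_enum.
rewrite pos_imset_first -addSnnS => vS e; right; apply/existsP.
exists (Ordinal (rk : (r < k)%N)); apply/exists_inP; exists v => //.
Qed.

(** ** One step of coalescence *)

(** Two walks merge only when one of them, at [a], moves onto the vertex
    [a + s t] at which the other one stays. *)
Lemma card_move s y t S :
  (#|move s y t @: S| +
   \sum_(a in S) [&& (a + s t)%R \in S, y (vtx t a) & ~~ y (vtx t (a + s t)%R)] =
   #|S|)%N.
Proof.
pose A := [set u in S | ~~ y (vtx t u)]; pose B := [set u in S | y (vtx t u)].
pose sh := fun u : V => u + s t.
have shI : injective sh by apply: addIr.
have -> : move s y t @: S = A :|: sh @: B.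
  apply/setP => v; apply/imsetP/setUP => [[u uS ->]|[|/imsetP[u]]].
  - rewrite /move; case: ifPn => yu; [right | left]; last by rewrite inE uS.
    by apply/imsetP; exists u; rewrite ?inE ?uS.
  - by rewrite inE => /andP[vS yv]; exists v; rewrite // /move (negPf yv).
  - by rewrite inE => /andP[uS yu] ->; exists u; rewrite // /move yu.
have -> : (\sum_(a in S) [&& (a + s t)%R \in S, y (vtx t a) & ~~ y (vtx t (a + s t)%R)] =
    #|sh @^-1: (A :&: sh @: B)|)%N.
  rewrite -[RHS]sum1_card big_mkcond [RHS]big_mkcond /=; apply: eq_bigr => a _.
  rewrite !inE mem_imset // !inE /sh.
  by case: (a \in S); case: (_ \in S); case: (y _); case: (y _).
rewrite card_preimset //.
have -> : #|S| = (#|A| + #|B|)%N.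
  rewrite -(cardsID [set u | y (vtx t u)] S) addnC; congr (_ + _)%N.
    by apply: eq_card => u; rewrite !inE andbC.
  by apply: eq_card => u; rewrite !inE.
by rewrite cardsUI card_imset.
Qed.

End Walks.

Lemma flip_inj n k : injective (@flip n k).
Proof. exact/inv_inj/(flip_at_involutive (a := fun=> k)). Qed.

(** The four ways of flipping the two bits exhaust the values of the pair. *)
Lemma avg_two_bits (R : realFieldType) n i j (G : cube n -> R) :
  (i < n)%N -> (j < n)%N -> i != j ->
  (forall x, G (flip i x) = G x) -> (forall x, G (flip j x) = G x) ->
  avg (fun x => G x * (bit x i && ~~ bit x j)%:R) = avg G / 4.
Proof.
move=> ni nj ij Gi Gj.
pose Q x := G x * (bit x i && ~~ bit x j)%:R.
have Qi := avg_reindex Q (@flip_inj n i).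
have Qj := avg_reindex Q (@flip_inj n j).
have Qij := avg_reindex Q (inj_comp (@flip_inj n i) (@flip_inj n j)).
have -> : avg G = avg Q + avg (fun x => Q (flip i x)) + avg (fun x => Q (flip j x))
    + avg (fun x => Q (flip i (flip j x))).
  rewrite -!avgD; apply: eq_avg => x.
  rewrite /Q !Gi !Gj !bit_flip // !eqxx (negPf ij) eq_sym (negPf ij) /=.
  by case: (bit x i); case: (bit x j) => /=; ring.
by rewrite Qi Qj Qij; field.
Qed.

(** The continuous model is [u' = - u^2 / (4 c)], with [1 / u] growing at rate
    [1 / (4 c)]. *)
Lemma harmonic_decay (R : realFieldType) (u : nat -> R) c K :
  0 < c -> (forall k, 0 <= u k) -> u 0%N <= 4 * c ->
  (forall k, (k <= K)%N -> u k.+1 <= u k - u k ^+ 2 / (4 * c)) ->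
  u K.+1 <= 4 * c / K.+1%:R.
Proof.
move=> c0 u0 uc; have c4 : 0 < 4 * c by rewrite mulr_gt0.
elim: K => [|K IH] hu.
  rewrite divr1 (le_trans (hu _ _)) // (le_trans _ uc) // gerBl.
  by rewrite divr_ge0 ?sqr_ge0 // ltW.
apply: le_trans (hu _ _) _ => //.
have := IH (fun k kK => hu k (leqW kK)).
have := u0 K.+1; set a := u K.+1; set k := K.+1%:R => a0 ak.
have k0 : 0 < k by rewrite ltr0n.
have k1 : 1 <= k by rewrite ler1n.
have -> : K.+2%:R = k + 1 :> R by rewrite -natr1.
rewrite ler_pdivlMr // in ak; rewrite ler_pdivlMr ?addr_gt0 //.
have -> : a - a ^+ 2 / (4 * c) = a * (4 * c - a) / (4 * c).
  by field; apply: lt0r_neq0.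
rewrite mulrAC ler_pdivrMr //.
(* [a <= 4 c / k]; the parabola is compared at [4 c / (k + 1)] *)
have [small|big] := lerP (a * (k + 1)) (4 * c); first by nra.
have a4 : a <= 4 * c by nra.
have h1 : (4 * c - a) * (k + 1) <= 4 * c * k by nra.
rewrite -(ler_pM2r k0).
have h2 : a * k * ((4 * c - a) * (k + 1)) <= 4 * c * (4 * c * k).
  apply: ler_pM => //; first by rewrite mulr_ge0 // ltW.
  by rewrite mulr_ge0 ?subr_ge0 // addr_ge0 // ltW.
nra.
Qed.

(** Bernoulli's inequality, applied to the inverse. *)
Lemma pow_1Binv_le (R : realFieldType) m :
  (0 < m)%N -> (1 - (m%:R)^-1) ^+ m <= 2^-1 :> R.
Proof.
case: m => [//|[_|m _]]; first by rewrite expr1 invr1 subrr invr_ge0.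
have m0 : 0 < m.+1%:R :> R by rewrite ltr0n.
have -> : 1 - m.+2%:R^-1 = (1 + m.+1%:R^-1)^-1 :> R.
  by rewrite -[m.+2]addn1 natrD; field; rewrite -?natr1 ?lt0r_neq0 //; lra.
rewrite exprVn lef_pV2 ?posrE ?exprn_gt0 ?addr_gt0 ?invr_gt0 //.
suff bern (a : R) k : 0 <= a -> 1 + k%:R * a <= (1 + a) ^+ k.
  apply: le_trans (bern m.+1%:R^-1 m.+2 _); last by rewrite invr_ge0 ltW.
  rewrite -[m.+2]addn1 natrD mulrDl mulfV ?lt0r_neq0 // mul1r.
  by rewrite addrA lerDl invr_ge0 ltW.
move=> a0; elim: k => [|k IH]; first by rewrite expr0 mul0r addr0.
rewrite exprS -natr1 (le_trans _ (ler_wpM2l _ IH)) ?addr_ge0 //.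
have : 0 <= k%:R :> R by rewrite ler0n.
nra.
Qed.

Section Averages.
Context (R : realFieldType) (n w' h : nat).
Let w := w'.+1.
Local Notation V := 'I_w'.+1.
Hypothesis hn : (h * w <= n)%N.
Implicit Types (x : cube n).

Let vtx_n t (v : V) : (t < h)%N -> (vtx t v < n)%N.
Proof. by move=> th; apply: leq_trans (vtx_lt v th) hn. Qed.

(** ** Rotation invariance *)

Definition rotate (c : V) : cube n -> cube n :=
  relabel h (fun _ v => v + c) false.

Lemma pos_rotate s c x T k v : (T + k <= h)%N ->
  pos s (bit (rotate c x)) T k v + c = pos s (bit x) T k (v + c).
Proof.
elim: k => [//|k IH]; rewrite addnS => Tk; rewrite !posS /move -IH 1?ltnW //.
rewrite bit_relabel //=; case: (bit x _) => //; exact: addrAC.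
Qed.

(** All vertices of a layer play the same role, so the average of a rotation
    equivariant quantity at one vertex is its average over the whole layer. *)
Lemma avg_equivariant (al : cube n -> V -> R) :
  (forall c x v, al (rotate c x) v = al x (v + c)) ->
  forall v, avg (al^~ v) = avg (fun x => \sum_u al x u) / w%:R.
Proof.
move=> alE v; rewrite avg_sum.
have e u : avg (al^~ u) = avg (al^~ v).
  have rI : injective (rotate (u - v)).
    by apply: relabel_inj => // t; apply: addIr.
  rewrite -[RHS](avg_reindex _ rI); apply: eq_avg => x.
  by rewrite alE addrC subrK.
under eq_bigr => u _ do rewrite e.
by rewrite sumr_const card_ord -[_ *+ _]mulr_natr mulfK // pnatr_eq0.
Qed.

(** The [w] walks are shared equally between the [w] vertices of a layer. *)
Lemma avg_visits (p : cube n -> V -> V) :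
  (forall c x v, p (rotate c x) v + c = p x (v + c)) ->
  forall u, avg (fun x => \sum_v (p x v == u)%:R) = 1 :> R.
Proof.
move=> pE u; pose al x u : R := \sum_v (p x v == u)%:R.
rewrite -[LHS]/(avg (al^~ u)) (avg_equivariant (al := al)) {}/al; last first.
  move=> c x a; rewrite [RHS](reindex_inj (addIr c)) /=; apply: eq_bigr => v _.
  by rewrite -pE (inj_eq (addIr c)).
rewrite (@eq_avg _ _ _ (fun=> w%:R)) => [|x].
  by rewrite avg_cst ?cube_gt0 // divff // pnatr_eq0.
rewrite exchange_big /= -[w in RHS]card_ord -sum1_card natr_sum.
apply: eq_bigr => v _; rewrite (bigD1 (p x v)) //= eqxx big1 ?addr0 //.
by move=> a; rewrite eq_sym => /negPf->.
Qed.

(** ** Coalescence with random shifts *)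

Definition walk_image s (y : nat -> bool) T k : {set V} := pos s y T k @: [set: V].

Lemma imageS s y T k : walk_image s y T k.+1 = move s y (T + k) @: walk_image s y T k.
Proof. by rewrite /walk_image -imset_comp; apply: eq_imset. Qed.

(** The number of pairs of occupied vertices which may merge under the shift [c]. *)
Definition crowding (S : {set V}) (c : V) : R :=
  \sum_(a in S) ((c != 0) && (a + c \in S))%:R.

Lemma sum_crowding (S : {set V}) :
  \sum_c crowding S c = #|S|%:R ^+ 2 - #|S|%:R.
Proof.
rewrite exchange_big /=.
have e a : a \in S -> \sum_(c : V) ((c != 0) && (a + c \in S))%:R = #|S|%:R - 1 :> R.
  move=> aS; rewrite (cardsD1 a) aS natrD addrAC subrr add0r -sum1_card natr_sum.
  rewrite [RHS]big_mkcond (reindex_inj (addIr (- a))) /=; apply: eq_bigr => b _.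
  rewrite subr_eq0 addrC subrK !inE.
  by case: eqP; case: (b \in S).
rewrite (eq_bigr _ e) sumr_const -[_ *+ _]mulr_natr; ring.
Qed.

Lemma avg_card_image s T k : (T + k < h)%N ->
  avg (fun x => #|walk_image s (bit x) T k.+1|%:R : R) =
  avg (fun x => #|walk_image s (bit x) T k|%:R) -
  avg (fun x => crowding (walk_image s (bit x) T k) (s (T + k)%N)) / 4.
Proof.
move=> Tk; set c := s (T + k)%N; pose S x := walk_image s (bit x) T k.
pose G a x : R := [&& a \in S x, c != 0 & a + c \in S x]%:R.
have SF x (a : V) : S (flip (vtx (T + k) a) x) = S x.
  by apply: eq_imset => v; apply: pos_flip => //; apply: vtx_n.
have e x : #|walk_image s (bit x) T k.+1|%:R = #|S x|%:R -
    \sum_a G a x * (bit x (vtx (T + k) a) && ~~ bit x (vtx (T + k) (a + c)))%:R :> R.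
  rewrite -[in #|S x|](card_move s (bit x) (T + k)) imageS natrD natr_sum.
  rewrite [X in _ + X - _]big_mkcond /= -addrA -sumrB big1 ?addr0 // => a _.
  rewrite -natrM mulnb /G -/c.
  case: eqP => [->|_]; last by case: (a \in _); rewrite ?subrr.
  rewrite addr0 andbN !andbF /=; by rewrite if_same subrr.
rewrite (eq_avg e) avgB avg_sum; congr (_ - _).
rewrite (eq_bigr (fun a => avg (G a) / 4)) => [|a _].
  rewrite -mulr_suml -avg_sum; congr (_ / _); apply: eq_avg => x.
  rewrite /crowding [RHS]big_mkcond /=; apply: eq_bigr => a _.
  by rewrite /G; case: (a \in _).
have [c0|c0] := eqVneq c 0.
  have G0 x : G a x = 0 by rewrite /G c0 eqxx andbF.
  rewrite (@eq_avg _ _ _ (fun=> 0)) => [|x]; last by rewrite G0 mul0r.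
  by rewrite (eq_avg G0) avg_cst ?cube_gt0 // mul0r.
apply: avg_two_bits; try exact: vtx_n.
- by rewrite vtx_eq eqxx /= -subr_eq0 opprD addNKr oppr_eq0.
- by move=> x; rewrite /G SF.
- by move=> x; rewrite /G SF.
Qed.

Definition schedule (s : {ffun 'I_h -> V}) (t : nat) : V := oapp s 0 (insub t).

Definition shift_at (t : 'I_h) (c : V) (s : {ffun 'I_h -> V}) :=
  [ffun j => if j == t then s j + c else s j].

Lemma avg_resample (t : 'I_h) (H : {ffun 'I_h -> V} -> V -> R) :
  (forall c s, H (shift_at t c s) = H s) ->
  avg (fun s => H s (s t)) = avg (fun s => (\sum_c H s c) / w%:R).
Proof.
move=> HE.
have e c : avg (fun s => H s (s t + c)) = avg (fun s => H s (s t)).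
  have shI : injective (shift_at t c).
    move=> s1 s2 /ffunP e12; apply/ffunP => j; have := e12 j; rewrite !ffunE.
    by case: eqP => // _ /addIr.
  rewrite -[RHS](avg_reindex _ shI); apply: eq_avg => s.
  by rewrite HE ffunE eqxx.
have w0 : w%:R != 0 :> R by rewrite pnatr_eq0.
apply: (mulIf w0).
transitivity (avg (fun s => \sum_c H s (s t + c))).
  by rewrite avg_sum (eq_bigr _ (fun c _ => e c)) sumr_const card_ord mulr_natr.
rewrite mulrC -avgZ; apply: eq_avg => s.
by rewrite mulrC divfK // [RHS](reindex_inj (addrI (s t))).
Qed.

Definition mean_image T k : R :=
  avg (fun s => avg (fun x => #|walk_image (schedule s) (bit x) T k|%:R)).

(** Given the past, the next shift is uniform, so every ordered pair of distinct
    occupied vertices merges with probability [1 / (4 w)]. *)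
Lemma mean_imageS T k : (T + k < h)%N ->
  mean_image T k.+1 = mean_image T k -
    avg (fun s => avg (fun x => #|walk_image (schedule s) (bit x) T k|%:R ^+ 2
                                - #|walk_image (schedule s) (bit x) T k|%:R))
    / (4 * w%:R).
Proof.
move=> Tk; pose t := Ordinal Tk.
rewrite /mean_image (eq_avg (fun s => avg_card_image (schedule s) Tk)) avgB.
congr (_ - _).
pose H s c := avg (fun x => crowding (walk_image (schedule s) (bit x) T k) c) / 4.
rewrite -[LHS]/(avg (fun s => H s (schedule s t))).
have st s : schedule s t = s t by rewrite /schedule valK.
rewrite (eq_avg (fun s => congr1 (H s) (st s))) avg_resample => [|c s]; last first.
  apply/funext => d; congr (_ / _); apply: eq_avg => x; congr crowding.
  apply: eq_imset => v; apply: eq_pos => // r rk; rewrite /schedule.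
  case: insubP => //= j _ jE; rewrite ffunE; case: eqP => // jt.
  by move: rk; rewrite -[(r < k)%N](ltn_add2l T) -jE jt ltnn.
rewrite -[in RHS]mulrC -avgZ; apply: eq_avg => s.
rewrite /H -mulr_suml -avg_sum (eq_avg (fun x => sum_crowding _)).
by rewrite invfM; ring.
Qed.

Lemma card_image_gt0 s y T k : (0 < #|walk_image s y T k|)%N.
Proof. by apply/card_gt0P; exists (pos s y T k 0); apply: imset_f. Qed.

Lemma mean_image_ge1 T k : 1 <= mean_image T k.
Proof.
have sch0 : (0 < #|{: {ffun 'I_h -> V}}|)%N by apply/card_gt0P; exists [ffun=> 0].
rewrite -[leLHS](avg_cst sch0); apply: le_avg => s.
rewrite -[leLHS](avg_cst (cube_gt0 n)); apply: le_avg => x.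
by rewrite ler1n card_image_gt0.
Qed.

Lemma mean_image0 T : mean_image T 0 = w%:R.
Proof.
have sch0 : (0 < #|{: {ffun 'I_h -> V}}|)%N by apply/card_gt0P; exists [ffun=> 0].
rewrite -[RHS](avg_cst sch0); apply: eq_avg => s.
rewrite -[RHS](avg_cst (cube_gt0 n)); apply: eq_avg => x.
by rewrite /walk_image imset_id cardsT card_ord.
Qed.

Let u T k : R := mean_image T k - 1.

Let w_gt0 : 0 < w%:R :> R. Proof. by rewrite ltr0n. Qed.

Let u_sqr T k : (T + k < h)%N -> u T k.+1 <= u T k - u T k ^+ 2 / (4 * w%:R).
Proof.
move=> Tk; rewrite /u mean_imageS // addrAC lerD2l lerN2.
rewrite ler_pM2r ?invr_gt0 ?mulr_gt0 //.
rewrite (eq_avg (fun s => avgB _ _)) avgB -/(mean_image T k).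
have := mean_image_ge1 T k; set m := mean_image T k => m1.
suff : m ^+ 2 <= avg (fun s => avg (fun x => #|walk_image (schedule s) (bit x) T k|%:R ^+ 2)).
  by nra.
have sch0 : (0 < #|{: {ffun 'I_h -> V}}|)%N by apply/card_gt0P; exists [ffun=> 0].
apply: le_trans (sqr_avg_le sch0 _) _; apply: le_avg => s.
exact: sqr_avg_le (cube_gt0 n) _.
Qed.

Let u_geo T k : (T + k < h)%N -> u T k.+1 <= u T k * (1 - (2 * w%:R)^-1).
Proof.
move=> Tk; rewrite /u mean_imageS // addrAC mulrBr mulr1 lerD2l lerN2.
have -> : (4 * w%:R)^-1 = 2^-1 * (2 * w%:R)^-1 :> R by rewrite -invfM; congr (_^-1); ring.
rewrite mulrA ler_pM2r ?invr_gt0 ?mulr_gt0 // ler_pdivlMr //.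
have sch0 : (0 < #|{: {ffun 'I_h -> V}}|)%N by apply/card_gt0P; exists [ffun=> 0].
rewrite -[X in (_ - X) * _ <= _](avg_cst sch0) -avgB mulrC -avgZ.
apply: le_avg => s.
rewrite -[X in _ * (_ - X) <= _](avg_cst (cube_gt0 n)) -avgB -avgZ.
apply: le_avg => x.
have := card_image_gt0 (schedule s) (bit x) T k.
case: #|_| => // -[|m] _; first by rewrite subrr mulr0 expr1n subrr.
have m0 : 0 <= m%:R :> R by rewrite ler0n.
have -> : m.+2%:R = m%:R + 2 :> R by rewrite -addn2 natrD.
nra.
Qed.

Let u_ge0 T k : 0 <= u T k.
Proof. by rewrite subr_ge0 mean_image_ge1. Qed.

(** By convexity, the mean of [N (N - 1)] is at least [m (m - 1)] where [m] is the
    mean of [N]. *)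
Lemma mean_image_harmonic T k : (T + k.+1 <= h)%N ->
  mean_image T k.+1 <= 1 + 4 * w%:R / k.+1%:R.
Proof.
move=> Tk; rewrite -lerBlDl.
apply: (@harmonic_decay _ (u T) w%:R k) => // [|j jk].
  by rewrite /u mean_image0; have := w_gt0; lra.
by apply: u_sqr; apply: leq_trans Tk; rewrite ltn_add2l.
Qed.

(** Sharper than the harmonic bound once few walks remain; it comes from
    [N (N - 1) >= 2 (N - 1)]. *)
Lemma mean_image_geometric T j : (T + 2 * w * j <= h)%N ->
  mean_image T (2 * w * j) <= 1 + w%:R / 2 ^+ j.
Proof.
move=> Tj; rewrite -lerBlDl.
have q : (1 - (2 * w%:R)^-1) ^+ (2 * w) <= 2^-1 :> R.
  by rewrite -natrM; apply: pow_1Binv_le.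
have q0 : 0 <= 1 - (2 * w%:R)^-1 :> R.
  by rewrite subr_ge0 invf_le1 ?mulr_gt0 // -natrM ler1n.
have step k : (k <= 2 * w * j)%N -> u T k <= w%:R * (1 - (2 * w%:R)^-1) ^+ k.
  elim: k => [_|k IH kj].
    by rewrite mulr1 /u mean_image0 gerBl.
  rewrite exprSr mulrA.
  have Tk : (T + k < h)%N by apply: leq_trans Tj; rewrite ltn_add2l.
  apply: le_trans (u_geo Tk) _; apply: ler_wpM2r => //.
  by apply: IH; apply: ltnW.
apply: le_trans (step _ (leqnn _)) _; rewrite ler_wpM2l // exprM -exprVn.
by rewrite lerXn2r ?nnegrE ?invr_ge0 // exprn_ge0.
Qed.

End Averages.
(** * Evaluating the end of a coalescing walk *)

Section Funnel.
Context (R : realType) (n w' h : nat).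
Let w := w'.+1.
Local Notation V := 'I_w'.+1.
Hypothesis hn : (h.+1 * w <= n)%N.
Variable s : nat -> V.

Definition final_bit (y : nat -> bool) : bool := y (vtx h (pos s y 0 h 0)).

Definition funnel_function : boolean_function n := fun x => final_bit (bit x).

Lemma funnel_balanced : balanced funnel_function.
Proof.
pose a (x : cube n) := vtx h (pos s (bit x) 0 h 0).
have an x : (a x < n)%N by apply: leq_trans hn; apply: vtx_lt.
have pF x : pos s (bit (flip (a x) x)) 0 h 0 = pos s (bit x) 0 h 0.
  by apply: pos_flip => //; apply: an.
apply: (@balanced_of_antisymmetry _ _ (fun x => flip (a x) x)).
  by apply/inv_inj/flip_at_involutive => x; rewrite /a pF.
move=> x; rewrite /funnel_function /final_bit pF bit_flip ?an //.
by rewrite eqxx.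
Qed.

(** A single remaining vertex certifies that the walk from vertex 0 ends there. *)
Definition conclude (S : {set V}) : decision_tree n :=
  if #|S| == 1%N then
    inspect [seq vtx h v | v <- enum S]
      (fun y => Output [exists v in S, y (vtx h v)])
  else inspect (iota 0 n) (fun y => Output (final_bit y)).

Definition funnel_tree (T : nat) (S : {set V}) : decision_tree n :=
  track s (h - T) T S conclude.

Lemma tree_eval_conclude (S : {set V}) x :
  (#|S| == 1%N -> pos s (bit x) 0 h 0 \in S) ->
  tree_eval (conclude S) x = funnel_function x.
Proof.
rewrite /conclude; case: ifP => [S1 /(_ isT) pS|_ _]; last first.
  by rewrite tree_eval_inspect seen_all.
have /cards1P[v Sv] := S1; rewrite Sv inE in pS.
rewrite tree_eval_inspect /= /funnel_function /final_bit (eqP pS) Sv.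
have seenv : seen [seq vtx h v0 | v0 <- enum [set v]] x (vtx h v) = bit x (vtx h v).
  by rewrite /seen map_f // mem_enum inE.
apply/exists_inP/idP => [[u]|bv]; first by rewrite inE => /eqP->; rewrite seenv.
by exists v; rewrite ?inE // seenv.
Qed.

Lemma funnel_tree_full T x : (T <= h)%N ->
  tree_eval (funnel_tree T [set: V]) x = funnel_function x.
Proof.
move=> Th; rewrite tree_eval_track tree_eval_conclude // => _.
rewrite -[in pos s _ 0 h 0](subnKC Th) pos_add add0n.
exact: imset_f.
Qed.

Lemma funnel_tree_single v x : #|walk_image s (bit x) 0 h| = 1%N ->
  tree_eval (funnel_tree 0 [set v]) x = funnel_function x.
Proof.
move=> N1; rewrite tree_eval_track subn0 tree_eval_conclude // => _.
rewrite imset_set1 inE; have /eqP/cards1P[u Nu] := N1.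
have im a : pos s (bit x) 0 h a = u.
  by apply/set1P; rewrite -Nu; apply: imset_f.
by rewrite !im.
Qed.

Lemma funnel_tree_reads T (S : {set V}) x (i : 'I_n) : (T <= h)%N ->
  tree_reads (funnel_tree T S) x i ->
  #|pos s (bit x) T (h - T) @: S| != 1%N \/
  exists k v, [/\ (T + k <= h)%N, v \in pos s (bit x) T k @: S & i = vtx (T + k) v :> nat].
Proof.
move=> Th; rewrite tree_reads_track => /orP[/existsP[[r rk] /exists_inP[v vS /eqP iE]]|].
  right; exists r, v; split => //.
  by rewrite -(subnKC Th) leq_add2l ltnW.
rewrite /conclude; case: ifPn => [_|]; last by left.
rewrite tree_reads_inspect orbF => /mapP[v vS iE]; right.
by exists (h - T)%N, v; rewrite subnKC // -mem_enum.
Qed.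

Lemma funnel_tree_reads_last T (S : {set V}) x : (0 < #|S|)%N ->
  exists v, tree_reads (funnel_tree T S) x (Ordinal (leq_trans (vtx_lt v (ltnSn h)) hn)).
Proof.
move=> /card_gt0P[u uS].
pose v := pos s (bit x) T (h - T) u; exists v.
rewrite tree_reads_track; apply/orP; right.
have vS : v \in pos s (bit x) T (h - T) @: S by apply: imset_f.
rewrite /conclude; case: ifP => _; rewrite tree_reads_inspect orbF.
  by apply: map_f; rewrite mem_enum.
by rewrite mem_iota /= (leq_trans (vtx_lt _ _) hn).
Qed.

End Funnel.

(** Some vertex of a layer is read with probability [1 / w] when every run reads
    a vertex of that layer. *)
Lemma max_read_prob_layer (R : realType) n w' t (J : finType) (A : {set J})
    (tau : J -> decision_tree n) (vn : forall v : 'I_w'.+1, (vtx t v < n)%N) :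
  (0 < #|A|)%N ->
  (forall j x, j \in A -> exists v, tree_reads (tau j) x (Ordinal (vn v))) ->
  w'.+1%:R^-1 <= max_read_prob (uniform_algorithm R [seq tau j | j <- enum A]).
Proof.
move=> A0 hr; set alg := uniform_algorithm _ _.
have A0' : 0 < #|A|%:R :> R by rewrite ltr0n.
have sum1 : 1 <= \sum_v read_prob alg (Ordinal (vn v)).
  under eq_bigr => v _ do rewrite read_prob_uniform //.
  rewrite -mulr_suml ler_pdivlMr // mul1r exchange_big /=.
  rewrite -sum1_card natr_sum; apply: ler_sum => j jA.
  under eq_bigr => v _ do rewrite cube_meanE.
  rewrite -avg_sum -[leLHS](avg_cst (cube_gt0 n)); apply: le_avg => x.
  have [v rv] := hr j x jA; rewrite (bigD1 v) //= rv lerDl.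
  by rewrite sumr_ge0 // => u _; rewrite ler0n.
have [v hv] : exists v, w'.+1%:R^-1 <= read_prob alg (Ordinal (vn v)).
  case: (pselect (exists v, w'.+1%:R^-1 <= read_prob alg (Ordinal (vn v)))) => // nh.
  have lt v : read_prob alg (Ordinal (vn v)) < w'.+1%:R^-1.
    by rewrite ltNge; apply/negP => ?; apply: nh; exists v.
  have : \sum_v read_prob alg (Ordinal (vn v)) < \sum_(v < w'.+1) w'.+1%:R^-1.
    by apply: ltr_sum => //; apply/hasP; exists ord0; rewrite ?mem_index_enum.
  rewrite sumr_const card_ord -[_ *+ _]mulr_natr mulVf ?pnatr_eq0 //.
  by move=> lt1; have := le_lt_trans sum1 lt1; rewrite ltxx.
by apply: le_trans hv _; rewrite /max_read_prob; apply: le_bigmax.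
Qed.

Section ReadFunnel.
Context (R : realType) (n w' h : nat).
Let w := w'.+1.
Local Notation V := 'I_w'.+1.
Hypothesis hn : (h.+1 * w <= n)%N.
Variable s : nat -> V.
Implicit Types (x : cube n).

Let size_image T t x : R := #|walk_image s (bit x) T (t - T)|%:R.

Let M T t : R := avg (size_image T t).

(** The steps before [T'] only restrict the set to which the later ones are applied,
    and the steps after [t'] can only merge vertices. *)
Lemma mean_card_image_le T T' t' t : (T <= T')%N -> (T' <= t')%N -> (t' <= t)%N ->
  M T t <= M T' t'.
Proof.
move=> TT' Tt' tt'; apply: le_avg => x; rewrite /size_image ler_nat.
have -> : (t - T = (T' - T) + (t' - T') + (t - t'))%N by clear -TT' Tt' tt'; lia.
rewrite /walk_image -[in leqLHS]addnA.
have -> y : pos s y T (T' - T + (t' - T' + (t - t'))) @: [set: V] =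
    pos s y t' (t - t') @: (pos s y T' (t' - T') @: (pos s y T (T' - T) @: [set: V])).
  rewrite -!imset_comp; apply: eq_imset => v /=.
  by rewrite !pos_add !subnKC.
apply: leq_trans (leq_imset_card _ _) _.
by apply: subset_leq_card; apply: imsetS; apply: finset.subsetT.
Qed.

Let uncoalesced T : avg (fun x => (#|walk_image s (bit x) T (h - T)| != 1%N)%:R) <= M T h - 1.
Proof.
rewrite -[X in _ <= _ - X](avg_cst (cube_gt0 n)) -avgB; apply: le_avg => x.
rewrite /size_image.
have := card_image_gt0 s (bit x) T (h - T).
case: #|_| => // -[|m] _; first by rewrite subrr.
by rewrite lerBrDr natr1 ler_nat.
Qed.

Let visit T t v : (t <= h)%N -> (T <= t)%N ->
  avg (fun x => (v \in walk_image s (bit x) T (t - T))%:R) = M T t / w%:R.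
Proof.
move=> th Tt.
rewrite (avg_equivariant hn (al := fun x v => (v \in walk_image s (bit x) T (t - T))%:R)).
  congr (_ / _); apply: eq_avg => x.
  rewrite /size_image -sum1_card natr_sum [RHS]big_mkcond.
  by apply: eq_bigr => u _; case: (u \in _).
move=> c x u; congr (_ %:R); congr nat_of_bool.
have rE a : pos s (bit (rotate h.+1 c x)) T (t - T) a + c = pos s (bit x) T (t - T) (a + c).
  by apply: pos_rotate => //; rewrite subnKC // ltnW // ltnS.
apply/imsetP/imsetP => [[a _ ->]|[a _ aE]].
  by exists (a + c); rewrite ?rE.
by exists (a - c) => //; apply: (addIr c); rewrite rE subrK.
Qed.

(** ** Small error, one walk *)

(** When all walks merge before time [h], the answer is right for every starting
    vertex. *)
Theorem single_walk_algorithm (eps : R) : 0 < eps -> M 0 h - 1 <= eps ->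
  exists f A, [/\ balanced f, mostly_correct eps A f,
    w%:R^-1 <= max_read_prob (A : randomized_algorithm R n)
    & max_read_prob A <= w%:R^-1].
Proof.
move=> e0 Me; pose tau v := funnel_tree n h s 0 [set v].
have V0 : (0 < #|[set: V]|)%N by rewrite cardsT card_ord.
exists (funnel_function h s), (uniform_algorithm R [seq tau v | v <- enum [set: V]]); split.
- exact: funnel_balanced.
- rewrite /mostly_correct.
  have sub x : 1 - (#|walk_image s (bit x) 0 (h - 0)| != 1%N)%:R <=
    ((1 - eps <= prob_correct (uniform_algorithm R [seq tau v | v <- enum [set: V]])
       (funnel_function h s) x)%R)%:R :> R.
    case: eqP => [N1|_] /=; last by rewrite subrr.
    rewrite prob_correct_eq1 // => [|v _]; last by apply: funnel_tree_single; rewrite -[h]subn0.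
    by rewrite gerBl (ltW e0) subr0.
  rewrite cube_probE; apply: le_trans (le_avg sub).
  rewrite avgB avg_cst ?cube_gt0 // lerD2l lerN2; exact: le_trans (uncoalesced 0) Me.
- apply: (@max_read_prob_layer _ _ _ h _ _ _
    (fun v => leq_trans (vtx_lt v (ltnSn h)) hn)) => // v x _.
  apply: funnel_tree_reads_last.
  by rewrite cards1.
- rewrite /max_read_prob; apply: bigmax_le => [|i _]; first by rewrite invr_ge0.
  rewrite read_prob_uniform // cardsT card_ord -[leRHS]mul1r ler_wpM2r ?invr_ge0 //.
  under eq_bigr => v _ do rewrite cube_meanE.
  rewrite -avg_sum; set t := (i %/ w)%N; pose u : V := inord (i %% w).
  have iE : i = vtx t u :> nat by rewrite /vtx inordK ?ltn_pmod // -divn_eq.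
  pose al x u := \sum_v (pos s (bit x) 0 t v == u)%:R : R.
  have le1 x : \sum_(v in [set: V]) (tree_reads (tau v) x i)%:R <= (t <= h)%:R * al x u.
    rewrite /al mulr_sumr; rewrite [leLHS](eq_bigl predT) => [|v]; last by rewrite inE.
    apply: ler_sum => v _; case rd: (tree_reads _ _ _) => /=; last by rewrite mulr_ge0.
    have [|[k [v' [kh vS e]]]] := funnel_tree_reads (leq0n h) rd.
      by rewrite imset_set1 cards1.
    move: vS e; rewrite imset_set1 inE iE => /eqP-> /vtx_inj[tk ->].
    by rewrite tk add0n in kh *; rewrite kh eqxx mulr1.
  apply: le_trans (le_avg le1) _; rewrite avgZ.
  case: leqP => th; last by rewrite mul0r.
  rewrite mul1r (avg_visits _ hn) // => c x v.
  by apply: (pos_rotate hn); rewrite leqW.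
Qed.

(** ** No error, many walks *)

(** The image of all walks from a time [T] only shrinks, so a time [t] inherits
    the bound of the last starting time before it: later starting times are
    absent, and the earlier ones have had longer to coalesce. *)
Lemma column_sum_le (start : {set 'I_h.+1}) (B : R) (t : nat) : 0 <= B ->
  (forall t, t \in start -> \sum_(T < h.+1 | (T <= t)%N) M T t <= B) ->
  \sum_(T in start | (T <= t)%N) M T t <= B.
Proof.
move=> B0 col.
have [[t0 t0s t0t]|none] := pselect (exists2 t0, t0 \in start & (t0 <= t)%N); last first.
  rewrite big1 // => T /andP[Ts Tt]; case: none; by exists T.
pose P (T : 'I_h.+1) := (T \in start) && (T <= t)%N.
have P0 : P t0 by rewrite /P t0s.
case: (@arg_maxnP _ t0 P (fun T => T : nat) P0) => t' /andP[t's t't] t'max.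
apply: le_trans (col t' t's).
rewrite big_mkcond [leRHS]big_mkcond /=; apply: ler_sum => T _.
have M0 : 0 <= M T t' by apply: avg_ge0 => x; rewrite ler0n.
case: ifPn => [/andP[Ts Tt]|_]; last by case: ifP.
have Tt' : (T <= t')%N by apply: t'max; rewrite /P Ts.
by rewrite Tt' mean_card_image_le.
Qed.

(** A bit in layer [t] is read either because some walk visits it, or because the
    walks did not merge. *)
Theorem multi_walk_algorithm (start : {set 'I_h.+1}) (B b : R) : (0 < #|start|)%N ->
  0 <= B ->
  (forall t, t \in start -> \sum_(T < h.+1 | (T <= t)%N) M T t <= B) ->
  (forall T, T \in start -> M T h - 1 <= b) ->
  exists f A, [/\ balanced f, always_correct A f,
    w%:R^-1 <= max_read_prob (A : randomized_algorithm R n)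
    & max_read_prob A <= B / #|start|%:R / w%:R + b].
Proof.
move=> start0 B0 col bad.
pose tau (T : 'I_h.+1) := funnel_tree n h s T [set: V].
have Th (T : 'I_h.+1) : (T <= h)%N by rewrite -ltnS.
have start0R : 0 < #|start|%:R :> R by rewrite ltr0n.
have b0 : 0 <= b.
  case/card_gt0P: start0 => T Ts; apply: le_trans (bad T Ts).
  by apply: le_trans (uncoalesced T); apply: avg_ge0 => x; rewrite ler0n.
exists (funnel_function h s), (uniform_algorithm R [seq tau T | T <- enum start]); split.
- exact: funnel_balanced.
- by move=> x; apply: prob_correct_eq1 => // T _; apply: funnel_tree_full.
- apply: (@max_read_prob_layer _ _ _ h _ _ _
    (fun v => leq_trans (vtx_lt v (ltnSn h)) hn)) => // T x _.
  by apply: funnel_tree_reads_last; rewrite cardsT card_ord.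
- have bound0 : 0 <= B / #|start|%:R / w%:R + b.
    by rewrite addr_ge0 // !divr_ge0 // ltW.
  rewrite /max_read_prob; apply: bigmax_le => // i _.
  rewrite read_prob_uniform //.
  under eq_bigr => T _ do rewrite cube_meanE.
  set t := (i %/ w)%N; pose u : V := inord (i %% w).
  have iE : i = vtx t u :> nat by rewrite /vtx inordK ?ltn_pmod // -divn_eq.
  have le1 T : T \in start -> avg (fun x => (tree_reads (tau T) x i)%:R) <=
      (if (T <= t)%N then M T t / w%:R else 0) + b.
    move=> Ts.
    have le2 x : (tree_reads (tau T) x i)%:R <=
        ((T <= t <= h)%N && (u \in walk_image s (bit x) T (t - T)))%:R
        + (#|walk_image s (bit x) T (h - T)| != 1%N)%:R :> R.
      case rd: (tree_reads _ _ _) => /=; last by rewrite addr_ge0.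
      have [->|[k [v [kh vS e]]]] := funnel_tree_reads (Th T) rd; first by rewrite lerDr.
      move: e vS; rewrite iE => /vtx_inj[-> ->] vS.
      by rewrite leq_addr kh addKn vS lerDl.
    apply: le_trans (le_avg le2) _; rewrite avgD lerD //; last first.
      exact: le_trans (uncoalesced T) (bad T Ts).
    case: (boolP (T <= t)%N) => Tt /=; last by rewrite avg_cst ?cube_gt0.
    case: (boolP (t <= h)%N) => th /=; first by rewrite visit.
    by rewrite avg_cst ?cube_gt0 // divr_ge0 // avg_ge0 // => x; rewrite ler0n.
  rewrite ler_pdivrMr // (le_trans (ler_sum _ le1)) // big_split /=.
  rewrite sumr_const -[b *+ _]mulr_natr mulrDl lerD2r.
  rewrite mulrAC divfK ?lt0r_neq0 // -big_mkcondr -mulr_suml.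
  by rewrite ler_wpM2r ?invr_ge0 // column_sum_le.
Qed.

End ReadFunnel.
(** * Choosing the shifts *)

(** Each dyadic block of the harmonic series contributes at most 1. *)
Lemma harmonic_le (R : realFieldType) p m : (m < 2 ^ p)%N ->
  \sum_(k < m) k.+1%:R^-1 <= p%:R :> R.
Proof.
elim: p m => [|p IH] m; first by rewrite ltnS leqn0 => /eqP->; rewrite big_ord0.
move=> mp; have [lt|ge] := ltnP m (2 ^ p).
  by apply: le_trans (IH _ lt) _; rewrite ler_nat.
have p0 : (0 < 2 ^ p)%N by rewrite expn_gt0.
pose q := (2 ^ p).-1; have qm : (q <= m)%N by rewrite /q; lia.
rewrite -(big_mkord xpredT (fun k => k.+1%:R^-1 : R)).
rewrite (big_cat_nat (n := q)) //= big_mkord -natr1 lerD //.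
  by apply: IH; rewrite /q; lia.
have le1 k : (q <= k < m)%N -> true -> k.+1%:R^-1 <= (2 ^ p)%:R^-1 :> R.
  by move=> /andP[qk _] _; rewrite lef_pV2 ?posrE ?ltr0n // ler_nat -(prednK p0).
rewrite big_nat_cond; apply: le_trans (ler_sum _ _) _.
  by move=> k /andP[/le1 h _]; apply: h.
rewrite -big_nat_cond sumr_const_nat -[_ *+ _]mulr_natr mulrC ler_pdivrMr ?ltr0n //.
by rewrite mul1r ler_nat; move: mp; rewrite expnS /q; lia.
Qed.

Section ChooseShifts.
Context (R : realType) (n w' : nat).
Let w := w'.+1.
Local Notation V := 'I_w'.+1.

Let w0 : 0 < w%:R :> R. Proof. by rewrite ltr0n. Qed.

Theorem small_error_construction (eps : R) (K : nat) : 0 < eps -> (0 < K)%N ->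
  4 <= K%:R * eps -> ((K * w).+1 * w <= n)%N ->
  exists f A, [/\ balanced f, mostly_correct eps A f,
    w%:R^-1 <= max_read_prob (A : randomized_algorithm R n)
    & max_read_prob A <= w%:R^-1].
Proof.
move=> e0 K0 Ke hn; set h := (K * w)%N in hn.
have h0 : (0 < h)%N by rewrite muln_gt0 K0.
have sch0 : (0 < #|{: {ffun 'I_h.+1 -> V}}|)%N by apply/card_gt0P; exists [ffun=> 0].
have bound : mean_image R n w' h.+1 0 h <= 1 + eps.
  have := @mean_image_harmonic R n w' h.+1 hn 0 h.-1; rewrite prednK // => /(_ (leqnSn _)).
  move=> /le_trans; apply; rewrite lerD2l ler_pdivrMr ?ltr0n //.
  by rewrite /h natrM mulrA ler_pM2r // mulrC.
have [s sP] := exists_le_avg sch0 bound.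
by apply: (single_walk_algorithm hn (s := schedule s)); rewrite // subn0 lerBlDl.
Qed.

(** The shifts are chosen so that the quantity [J] below is at most 2: its first
    term is the average over the first half of the layers of the column sums,
    relatively to the bound [B] of their means, and its second term bounds the
    probability that the walks from the middle layer do not merge.  By Markov's
    inequality, half of the possible starting times have a column sum of at most
    [4 B]. *)
Theorem zero_error_construction (l : nat) : (0 < l)%N -> (w <= 2 ^ l)%N ->
  ((2 * (4 * w * l)).+1 * w <= n)%N ->
  exists f A, [/\ balanced f, always_correct A f,
    w%:R^-1 <= max_read_prob (A : randomized_algorithm R n)
    & max_read_prob A <= 44 / w%:R].
Proof.
move=> l0 wl; set g := (4 * w * l)%N; set h := (2 * g)%N => hn.
have sch0 : (0 < #|{: {ffun 'I_h.+1 -> V}}|)%N by apply/card_gt0P; exists [ffun=> 0].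
have g0 : (0 < g)%N by rewrite !muln_gt0.
have gh : (g <= h)%N by rewrite leq_pmull.
have l0R : 0 < l%:R :> R by rewrite ltr0n.
pose M (s : {ffun 'I_h.+1 -> V}) T t : R :=
  avg (fun x : cube n => #|walk_image (schedule s) (bit x) T (t - T)|%:R).
pose W (s : {ffun 'I_h.+1 -> V}) (t : nat) := \sum_(T < h.+1 | (T <= t)%N) M s T t.
pose B : R := 21 * w%:R * l%:R.
have B0 : 0 < B by rewrite !mulr_gt0.
have colB t : (t < g)%N -> avg (fun s => W s t) <= B.
  move=> tg; rewrite avg_sum.
  pose F k : R := if k is 0 then w%:R else 1 + 4 * w%:R / k%:R.
  have le1 (T : 'I_h.+1) : (T <= t)%N -> avg (fun s => M s T t) <= F (t - T)%N.
    move=> Tt; rewrite -[leLHS]/(mean_image R n w' h.+1 T (t - T)).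
    case E: (t - T)%N => [|k]; first by rewrite mean_image0.
    apply: mean_image_harmonic => //; rewrite -E subnKC // ltnW //.
    by apply: leq_trans (leq_trans tg gh) (leqnSn _).
  apply: le_trans (ler_sum _ le1) _.
  have th : (t.+1 <= h.+1)%N by rewrite ltnS (leq_trans _ gh) // ltnW.
  rewrite -(big_ord_widen _ (fun T => F (t - T)%N) th).
  rewrite (reindex_inj rev_ord_inj) /=.
  rewrite (eq_bigr (fun k : 'I_t.+1 => F k)) => [|k _]; last first.
    by rewrite subSS subKn // -ltnS.
  rewrite big_ord_recl /=.
  rewrite big_split /= sumr_const card_ord -mulr_sumr.
  have hl : (t < 2 ^ (2 * l + 2))%N.
    apply: leq_trans tg _; rewrite /g expnD mulnC mul2n -addnn expnD.
    by have := ltn_expl l (ltnSn 1); nia.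
  have := harmonic_le R hl; set S := \sum_(k < t) _ => hS.
  have tg' : t%:R <= 4 * w%:R * l%:R :> R by rewrite -!natrM ler_nat ltnW.
  have l1 : 1 <= l%:R :> R by rewrite ler1n.
  have S4 : S <= 4 * l%:R by apply: le_trans hS _; rewrite natrD natrM; lra.
  rewrite -mulr_natr mul1r /B.
  have e1 : w%:R <= w%:R * l%:R :> R by rewrite ler_peMr // ltW.
  have e2 : 4 * w%:R * S <= 4 * w%:R * (4 * l%:R) by rewrite ler_pM2l // mulr_gt0.
  lra.
have lastB : avg (fun s => M s g h) - 1 <= w%:R^-1.
  have gj : (g = 2 * w * (2 * l))%N by rewrite /g; lia.
  rewrite -[X in X - _ <= _]/(mean_image R n w' h.+1 g (h - g)).
  have -> : (h - g = 2 * w * (2 * l))%N by rewrite /h; lia.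
  rewrite lerBlDl; have le := @mean_image_geometric R n w' h.+1 hn g (2 * l).
  apply: le_trans (le _) _; first by rewrite -gj /h; lia.
  rewrite lerD2l ler_pdivrMr ?exprn_gt0 // mulrC ler_pdivlMr //.
  by rewrite -natrX -natrM ler_nat [(2 * l)%N]mulnC expnM -mulnn leq_mul.
pose J s := (g%:R * B)^-1 * (\sum_(t < h.+1 | (t < g)%N) W s t) + w%:R * (M s g h - 1).
have g0R : 0 < g%:R :> R by rewrite ltr0n.
have cardg : \sum_(t < h.+1 | (t < g)%N) (1 : R) = g%:R.
  by rewrite -(big_ord_widen _ (fun=> 1) (leqW gh)) sumr_const card_ord.
have J2 : avg J <= 2.
  rewrite /J avgD !avgZ avgB avg_cst // avg_sum.
  have -> : 2 = 1 + 1 :> R by [].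
  apply: lerD; last by rewrite mulrC -ler_pdivlMr // mul1r.
  rewrite mulrC ler_pdivrMr ?mulr_gt0 // mul1r -cardg mulr_suml.
  by apply: ler_sum => t tg; rewrite mul1r colB.
have [s Js] := exists_le_avg sch0 J2.
have M1 T t : 1 <= M s T t.
  rewrite -[leLHS](avg_cst (cube_gt0 n)); apply: le_avg => x.
  by rewrite ler1n card_image_gt0.
have W0 t : 0 <= W s t by apply: sumr_ge0 => T _; apply: le_trans (M1 _ _).
have sumW : \sum_(t < h.+1 | (t < g)%N) W s t <= 2 * (g%:R * B).
  rewrite -ler_pdivrMr ?mulr_gt0 //; rewrite mulrC; apply: le_trans Js.
  rewrite lerDl.
  by rewrite mulr_ge0 ?subr_ge0 // ltW.
have lastM : M s g h - 1 <= 2 / w%:R.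
  rewrite ler_pdivlMr // mulrC; apply: le_trans Js; rewrite lerDr.
  by rewrite mulr_ge0 ?sumr_ge0 // invr_ge0 ltW // mulr_gt0.
pose start : {set 'I_h.+1} := [set t : 'I_h.+1 | (t < g)%N && (W s t <= 4 * B)].
have start_card : g%:R <= 2 * #|start|%:R :> R.
  have : \sum_(t < h.+1 | (t < g)%N) (1 - (t \in start)%:R) * (4 * B) <= 2 * (g%:R * B).
    apply: le_trans sumW; apply: ler_sum => t tg; rewrite inE tg /=.
    case: (lerP (W s t) (4 * B)) => [_|/ltW h4]; first by rewrite subrr mul0r W0.
    by rewrite subr0 mul1r.
  rewrite -mulr_suml big_split /= cardg sumrN.
  have -> : \sum_(t < h.+1 | (t < g)%N) (t \in start)%:R = #|start|%:R :> R.
    rewrite -sum1_card natr_sum big_mkcond [RHS]big_mkcond /=.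
    by apply: eq_bigr => t _; rewrite !inE; case: (t < g)%N; case: (_ <= _).
  by nra.
have start0R : 0 < #|start|%:R :> R by lra.
have start0 : (0 < #|start|)%N by move: start0R; rewrite ltr0n.
have [||||f [A [bf cA lo hi]]] := @multi_walk_algorithm R n w' h hn (schedule s)
  start (4 * B) (2 / w%:R) => //.
- by rewrite mulr_ge0 // ltW.
- by move=> t; rewrite inE => /andP[].
- move=> T; rewrite inE => /andP[Tg _]; apply: le_trans lastM.
  by rewrite lerD2r; apply: mean_card_image_le => //; apply: ltnW.
exists f, A; split => //; apply: le_trans hi _.
rewrite -mulrDl ler_pM2r ?invr_gt0 //.
suff : 4 * B / #|start|%:R <= 42 by lra.
rewrite ler_pdivrMr // /B.
by move: start_card; rewrite /g !natrM; nra.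
Qed.

End ChooseShifts.
(** * A monotone function on the discrete torus *)

Section Winding.
Context (w' : nat).
Let w := w'.+1.
Local Notation V := 'I_w'.+1.
Implicit Types (y : nat -> bool) (v : V).

Let one : nat -> V := fun=> inZp 1.

Lemma inZpD i j : inZp (i + j) = inZp i + inZp j :> V.
Proof. by apply: val_inj; rewrite /= modnDm. Qed.

Lemma onesS y k v : ones one y 0 k.+1 v = (ones one y 0 k v + y (vtx k (pos one y 0 k v)))%N.
Proof. by rewrite /ones big_ord_recr. Qed.

Lemma pos_ones y k v : pos one y 0 k v = v + inZp (ones one y 0 k v).
Proof.
elim: k => [|k IH].
  by rewrite /ones big_ord0 (_ : inZp 0 = 0) ?addr0 //; apply: val_inj; rewrite /= mod0n.
rewrite posS onesS /move add0n inZpD addrA -IH.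
by case: (y _) => //; rewrite (_ : inZp false = 0) ?addr0 //; apply: val_inj; rewrite /= mod0n.
Qed.

(** The walk lifted to the universal cover of the circle. *)
Definition lift y k (i : nat) : nat := (i + ones one y 0 k (inZp i))%N.

Lemma pos_lift y k i : pos one y 0 k (inZp i) = inZp (lift y k i).
Proof. by rewrite pos_ones -inZpD. Qed.

Lemma liftS y k i : lift y k.+1 i = (lift y k i + y (vtx k (inZp (lift y k i) : V)))%N.
Proof. by rewrite /lift onesS pos_lift addnA. Qed.

(** Lifted walks never overtake one another, and more [true] bits move them
    further. *)
Lemma lift_mono y y' k i i' : (forall j, y j ==> y' j) -> (i <= i')%N ->
  (lift y k i <= lift y' k i')%N.
Proof.
move=> yy' ii'; elim: k => [|k IH]; first by rewrite /lift /ones !big_ord0 !addn0.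
rewrite !liftS; move: IH; rewrite leq_eqVlt => /orP[/eqP->|lt].
  rewrite leq_add2l; have := yy' (vtx k (inZp (lift y' k i') : V)).
  by case: (y _); case: (y' _).
by case: (y _); case: (y' _) => /=; lia.
Qed.

Lemma lift_period y k i : lift y k (i + w) = (lift y k i + w)%N.
Proof.
rewrite /lift addnAC; congr (_ + ones _ _ _ _ _ + _)%N.
by apply: val_inj; rewrite /= modnDr.
Qed.

Lemma lift_val y k v : lift y k v = (v + ones one y 0 k v)%N.
Proof. by rewrite /lift valZpK. Qed.

Context (m : nat).
Let h := (w * (2 * m).+1)%N.

Definition winds_high y := [exists v : V, (w * m.+1 <= ones one y 0 h v)%N].
Definition winds_low y := [exists v : V, (ones one y 0 h v <= w * m)%N].

(** The tie is broken by the bit of the vertex fixed by the reflection. *)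

Definition winding_bit y := winds_high y || ~~ winds_low y && y 0.

(** Over one turn of the starting point, lifted walks stay within [w] of each
    other. *)
Lemma winds_exclusive y : winds_high y -> ~~ winds_low y.
Proof.
move=> /existsP[i hi]; apply/negP => /existsP[j hj].
have im : forall b, y b ==> y b by move=> b; apply: implybb.
have [ij|ji] := leqP i j.
  have := lift_mono h im ij; rewrite !lift_val.
  by have := ltn_ord j; rewrite -/w; lia.
have iw : (i <= j + w)%N by apply: leq_trans (ltnW (ltn_ord i)) (leq_addl _ _).
by have := lift_mono h im iw; rewrite lift_period !lift_val; lia.
Qed.

Lemma winding_bit_mono y y' : (forall j, y j ==> y' j) ->
  winding_bit y ==> winding_bit y'.
Proof.
move=> yy'; have le v : (ones one y 0 h v <= ones one y' 0 h v)%N.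
  by have := lift_mono h yy' (leqnn v); rewrite !lift_val leq_add2l.
apply/implyP => /orP[/existsP[v hv]|/andP[low y0]]; apply/orP.
  by left; apply/existsP; exists v; apply: leq_trans hv (le v).
right; apply/andP; split; last by have := yy' 0%N; rewrite y0.
by apply: contra low => /existsP[v hv]; apply/existsP; exists v; apply: leq_trans (le v) hv.
Qed.

(** The number of turns of a closed walk is an integer, so its advance cannot lie
    strictly between [w m] and [w (m + 1)]. *)
Lemma winding_bit_fixpoint y v : pos one y 0 h v = v ->
  winding_bit y = (w * m.+1 <= ones one y 0 h v)%N.
Proof.
rewrite pos_ones => /eqP; rewrite addrC -subr_eq0 addrK => /eqP/(congr1 val) /= dv.
have {dv} dv : ones one y 0 h v = (ones one y 0 h v %/ w * w)%N.
  by rewrite {1}(divn_eq (ones one y 0 h v) w) -[w in (_ %% w)%N]/(w'.+1) dv addn0.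
have [ge|lt] := leqP (w * m.+1) (ones one y 0 h v).
  by apply/orP; left; apply/existsP; exists v.
have low : winds_low y.
  apply/existsP; exists v; move: lt; rewrite dv [(_ * w)%N]mulnC.
  by rewrite ltn_mul2l leq_mul2l ltnS.
rewrite /winding_bit low /= orbF; apply/negbTE/negP => /winds_exclusive.
by rewrite low.
Qed.

Context (n : nat).
Hypothesis hn : (h * w <= n)%N.

Definition winding_function : boolean_function n := fun x => winding_bit (bit x).

Lemma winding_function_monotone : monotone_function winding_function.
Proof.
move=> x y yx; apply: winding_bit_mono => j; rewrite /bit.
by case: insub.
Qed.

Definition reflection : cube n -> cube n :=
  relabel h (fun t v => inZp t - v) true.

(** A step of [0] or [1] becomes a step of [1] or [0] after negation of its bit, so
    a reflected walk at time [k] is at [k - v] instead of [v]. *)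
Lemma pos_reflection x k v : (k <= h)%N ->
  pos one (bit (reflection x)) 0 k (- v) = inZp k - pos one (bit x) 0 k v /\
  (ones one (bit (reflection x)) 0 k (- v)%R + ones one (bit x) 0 k v = k)%N.
Proof.
elim: k => [_|k IH kh].
  by rewrite /ones !big_ord0 (_ : inZp 0 = 0) ?sub0r //; apply: val_inj; rewrite /= mod0n.
have [IHp IHo] := IH (ltnW kh).
rewrite !posS !onesS /move IHp add0n bit_relabel // subKr -[k.+1]addn1 inZpD.
case: (bit x _) => /=; split; first by rewrite opprD addrACA subrr addr0.
- by rewrite addn0 addnA IHo.
- by rewrite addrAC.
- by rewrite addn0 addnAC IHo.
Qed.

Lemma winding_function_balanced : balanced winding_function.
Proof.
apply: (@balanced_of_antisymmetry _ _ reflection).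
  by apply: relabel_inj => // t u v /addrI/oppr_inj.
move=> x; rewrite /winding_function /winding_bit.
have -> : winds_high (bit (reflection x)) = winds_low (bit x).
  apply/existsP/existsP => -[v hv].
    exists (- v); have [_] := pos_reflection x (- v) (leqnn h); rewrite opprK.
    by rewrite /h in hv *; lia.
  exists (- v); have [_] := pos_reflection x v (leqnn h).
  by rewrite /h in hv *; lia.
have -> : winds_low (bit (reflection x)) = winds_high (bit x).
  apply/existsP/existsP => -[v hv].
    exists (- v); have [_] := pos_reflection x (- v) (leqnn h); rewrite opprK.
    by rewrite /h in hv *; lia.
  exists (- v); have [_] := pos_reflection x v (leqnn h).
  by rewrite /h in hv *; lia.
have h0 : (0 < h)%N by [].
have := bit_relabel (fun t v => inZp t - v) true x (0 : V) hn h0.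
rewrite -/reflection (_ : inZp 0 - 0 = 0 :> V); last first.
  by rewrite subr0; apply: val_inj; rewrite /= mod0n.
rewrite /vtx mul0n addn0 => ->.
have := @winds_exclusive (bit x).
by case: (winds_high _) => [/(_ isT)/negPf->|_] //=; case: (winds_low _); case: (bit x _).
Qed.

(** ** The algorithm *)

(** The first round leads to the vertex [v1], from which the second round is closed
    as soon as all walks have coalesced.  A lazy tree does not check it. *)
Definition winding_tree (lazy : bool) (v : V) : decision_tree n :=
  follow one h 0 v 0 (fun v1 _ =>
  follow one h 0 v1 0 (fun v2 c =>
    if lazy || (v2 == v1) then Output (w * m.+1 <= c)%N
    else inspect (iota 0 n) (fun y => Output (winding_bit y)))).

Definition coalesced (x : cube n) :=
  [forall v : V, pos one (bit x) 0 h v == pos one (bit x) 0 h (v + inZp 1)].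

Lemma coalesced_const x u v : coalesced x ->
  pos one (bit x) 0 h u = pos one (bit x) 0 h v.
Proof.
move=> /forallP cx; suff h0 k : pos one (bit x) 0 h (inZp k) = pos one (bit x) 0 h 0.
  by rewrite -[u]valZpK -[v]valZpK !h0.
elim: k => [|k <-]; first by congr pos; apply: val_inj; rewrite /= mod0n.
by rewrite -[k.+1]addn1 inZpD; apply/esym/eqP.
Qed.

Lemma winding_tree_correct lazy v x : ~~ lazy || coalesced x ->
  tree_eval (winding_tree lazy v) x = winding_function x.
Proof.
move=> ok; rewrite tree_eval_follow tree_eval_follow add0n.
case: ifP => [H|_]; last by rewrite tree_eval_inspect seen_all.
rewrite /= /winding_function (@winding_bit_fixpoint _ (pos one (bit x) 0 h v)) //.
move: ok H; case: lazy => /= [cx _|_ /eqP //].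
exact: coalesced_const.
Qed.

Lemma winding_tree_reads lazy v x (i : 'I_n) t u : i = vtx t (u : V) :> nat ->
  tree_reads (winding_tree lazy v) x i ->
  (t < h)%N && ((pos one (bit x) 0 t v == u) ||
                (pos one (bit x) 0 t (pos one (bit x) 0 h v) == u)) ||
  ~~ lazy && ~~ coalesced x.
Proof.
move=> iE; rewrite tree_reads_follow tree_reads_follow iE.
case/or3P => [/existsP[r]|/existsP[r]|].
- by rewrite add0n vtx_eq => /andP[/eqP-> /eqP->]; rewrite ltn_ord eqxx.
- by rewrite add0n vtx_eq => /andP[/eqP-> /eqP->]; rewrite ltn_ord eqxx orbT.
case: ifPn => //; rewrite negb_or => /andP[-> neq] _; apply/orP; right => /=.
by apply: contra neq => cx; apply/eqP/coalesced_const.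
Qed.

Lemma winding_tree_reads_first lazy v x (i : 'I_n) : i = vtx 0 v :> nat ->
  tree_reads (winding_tree lazy v) x i.
Proof.
move=> iE; rewrite tree_reads_follow; apply/orP; left; apply/existsP.
have h0 : (0 < h)%N by [].
by exists (Ordinal h0); rewrite iE addn0.
Qed.

End Winding.
(** * Coalescence on the cycle *)

Section Cycle.
Context (R : realType) (n w' h : nat).
Let w := w'.+1.
Local Notation V := 'I_w'.+1.
Hypothesis hn : (h * w <= n)%N.
Implicit Types (x : cube n) (d u v : V).

Let one : nat -> V := fun=> inZp 1.

Let vtx_n t v : (t < h)%N -> (vtx t v < n)%N.
Proof. by move=> th; apply: leq_trans (vtx_lt v th) hn. Qed.

(** Half the expected number of steps before two walks at displacement [d] meet:
    before that time their displacement is a lazy random walk, and [gap] drops by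
    [1 / 2] on average in each step. *)
Definition gap d : R := d%:R * (w%:R - d%:R).

Lemma val_add1 d : (d + inZp 1 : V) = (if d.+1 == w then 0%N else d.+1) :> nat.
Proof.
rewrite /= modnDmr addn1; case: eqP => [->|dw]; first by rewrite modnn.
by rewrite modn_small // ltn_neqAle ltn_ord andbT; apply/eqP.
Qed.

Lemma gap_add1 d : gap (d + inZp 1) = (d%:R + 1) * (w%:R - (d%:R + 1)).
Proof.
rewrite /gap val_add1; case: eqP => [e|_]; last by rewrite -natr1.
by rewrite natr1 e subrr mulr0 mul0r.
Qed.

Lemma gap_sub1 d : d != 0 -> gap (d - inZp 1) = (d%:R - 1) * (w%:R - (d%:R - 1)).
Proof.
move=> d0; set e := d - inZp 1.
have de : d = e + inZp 1 by rewrite subrK.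
have dE : d = e.+1 :> nat.
  have := val_add1 e; rewrite -de; case: eqP => // _ dz.
  by case/eqP: d0; apply: val_inj.
by rewrite /gap dE -natr1 addrK.
Qed.

Lemma gap0 : gap 0 = 0. Proof. by rewrite /gap mul0r. Qed.

Lemma gap_ge0 d : 0 <= gap d.
Proof. by rewrite mulr_ge0 // subr_ge0 ler_nat ltnW. Qed.

Lemma gap_ge1 d : d != 0 -> 1 <= gap d.
Proof.
move=> d0; have dpos : (0 < d)%N.
  by rewrite lt0n; apply: contra d0 => /eqP d0; apply/eqP/val_inj.
rewrite /gap -natrB; last exact/ltnW.
by rewrite -natrM ler1n muln_gt0 dpos subn_gt0 ltn_ord.
Qed.

Lemma gap_le d : gap d <= w%:R ^+ 2 / 2 * (d != 0)%:R.
Proof.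
case: eqVneq => [->|_]; first by rewrite gap0 mulr0.
rewrite mulr1 ler_pdivlMr // /gap; set a : R := w%:R; set b : R := d%:R.
by have := sqr_ge0 (a - 2 * b); have := sqr_ge0 a; nra.
Qed.

Let P x t v := pos one (bit x) 0 t v.

(** The bits read by the two walks are distinct as long as they have not met;
    flipping either or both of them averages [gap] over the four possible moves. *)
Let avg_gapS u v t : (t < h)%N ->
  avg (fun x => gap (P x t.+1 v - P x t.+1 u)) =
  avg (fun x => gap (P x t v - P x t u)) - avg (fun x => (P x t v != P x t u)%:R) / 2.
Proof.
move=> th.
pose F a x := flip (vtx t (P x t a)) x.
have PF (a b : V) x : P (flip (vtx t a) x) t b = P x t b.
  by apply: pos_flip => //; apply: vtx_n.
have PS x a : P x t.+1 a = move one (bit x) t (P x t a) by rewrite /P posS add0n.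
have FI a : injective (F a).
  by apply/inv_inj/flip_at_involutive => x; rewrite PF.
pose Q x := gap (P x t.+1 v - P x t.+1 u).
have sumQ x : Q x + Q (F u x) + Q (F v x) + Q (F v (F u x)) =
    4 * gap (P x t v - P x t u) - 2 * (P x t v != P x t u)%:R.
  rewrite /Q /F !PS !PF /move.
  rewrite !bit_flip ?vtx_n // !vtx_eq !eqxx /= [P x t u == _]eq_sym.
  have [->|neq] := eqVneq (P x t v) (P x t u).
    by rewrite !subrr gap0 !addr0 !mulr0 subrr.
  have dn0 : P x t v - P x t u != 0 by rewrite subr_eq0.
  set d := _ - _ in dn0 *.
  have e1 : P x t v - (P x t u + one t) = d - inZp 1 by rewrite opprD addrA.
  have e2 : P x t v + one t - P x t u = d + inZp 1 by rewrite addrAC.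
  have e3 : P x t v + one t - (P x t u + one t) = d by rewrite opprD addrACA subrr addr0.
  have sum4 : gap (d + inZp 1) + gap (d - inZp 1) = 2 * gap d - 2.
    by rewrite gap_add1 gap_sub1 // /gap; ring.
  rewrite mulr1.
  by case: (bit x _); case: (bit x _); rewrite /= e1 e2 e3; lra.
have := eq_avg sumQ; rewrite [in RHS]avgB !avgD !avgZ.
rewrite -/(Q \o F u) (avg_reindex Q (FI u)) (avg_reindex Q (FI v)).
by rewrite (avg_reindex Q (inj_comp (FI v) (FI u))) /Q; lra.
Qed.

(* The walks from neighbouring vertices are compared; when all these pairs have
   met, all walks have coalesced. *)
Let alive t : R := \sum_v avg (fun x => (P x t (v + inZp 1) != P x t v)%:R).
Let energy t : R := \sum_v avg (fun x => gap (P x t (v + inZp 1) - P x t v)).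

Let energyS t : (t < h)%N -> energy t.+1 = energy t - alive t / 2.
Proof.
move=> th; rewrite /energy /alive mulr_suml -sumrB.
by apply: eq_bigr => v _; rewrite avg_gapS.
Qed.

Let aliveS t : alive t.+1 <= alive t.
Proof.
apply: ler_sum => v _; apply: le_avg => x.
case: (eqVneq (P x t (v + inZp 1)) (P x t v)) => [e|_]; last by rewrite ler_nat leq_b1.
by rewrite /P !posS -/(P x t (v + inZp 1)) e eqxx.
Qed.

Let alive_le_energy t : alive t <= energy t.
Proof.
apply: ler_sum => v _; apply: le_avg => x.
case: eqVneq => [->|neq]; first by rewrite subrr gap0.
by rewrite gap_ge1 // subr_eq0.
Qed.

Let energy_le_alive t : energy t <= w%:R ^+ 2 / 2 * alive t.
Proof.
rewrite /alive mulr_sumr; apply: ler_sum => v _; rewrite -avgZ.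
by apply: le_avg => x; have := gap_le (P x t (v + inZp 1) - P x t v); rewrite subr_eq0.
Qed.

Let energy0 : energy 0 <= w%:R ^+ 2.
Proof.
have le v : avg (fun x => gap (P x 0 (v + inZp 1) - P x 0 v)) <= w%:R.
  rewrite -[leRHS](avg_cst (cube_gt0 n)); apply: le_avg => x; rewrite /P /=.
  rewrite addrAC subrr gap_add1 /= add0r mul1r; lra.
apply: le_trans (ler_sum _ (fun v _ => le v)) _.
by rewrite sumr_const card_ord -[_ *+ _]mulr_natr expr2.
Qed.

Let energy_ge0 t : 0 <= energy t.
Proof. by apply: sumr_ge0 => v _; apply: avg_ge0 => x; apply: gap_ge0. Qed.

Let alive_anti t : (t <= h)%N -> alive h <= alive t.
Proof.
move=> /subnKC <-; elim: (h - t)%N => [|k IH]; first by rewrite addn0.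
by rewrite addnS; apply: le_trans (aliveS _) IH.
Qed.

(** The energy loses [alive / 2] in each layer. *)
Lemma alive_harmonic : h%:R * alive h <= 2 * w%:R ^+ 2.
Proof.
suff : energy h <= energy 0 - h%:R * (alive h / 2).
  by have := energy0; have := energy_ge0 h; lra.
have step t : (t <= h)%N -> energy t <= energy 0 - t%:R * (alive h / 2).
  elim: t => [_|t IH th]; first by rewrite mul0r subr0.
  rewrite energyS // -[t.+1%:R]natr1 mulrDl mul1r opprD addrA.
  rewrite lerD ?IH ?lerN2 //; first exact: ltnW.
  by rewrite ler_pM2r ?invr_gt0 // alive_anti // ltnW.
exact: step.
Qed.

Lemma alive_geometric : alive h <= w%:R ^+ 2 * (1 - (w%:R ^+ 2)^-1) ^+ h.
Proof.
apply: le_trans (alive_le_energy h) _.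
have w20 : 0 < w%:R ^+ 2 :> R by rewrite exprn_gt0 ?ltr0n.
have q0 : 0 <= 1 - (w%:R ^+ 2)^-1 :> R.
  by rewrite subr_ge0 invf_le1 // -natrX ler1n expn_gt0.
have step t : (t <= h)%N -> energy t <= w%:R ^+ 2 * (1 - (w%:R ^+ 2)^-1) ^+ t.
  elim: t => [_|t IH th]; first by rewrite expr0 mulr1.
  rewrite [_ ^+ t.+1]exprSr mulrA; apply: le_trans (ler_wpM2r q0 (IH (ltnW th))).
  rewrite energyS // mulrBr mulr1 lerD2l lerN2 ler_pdivrMr //.
  by have := energy_le_alive t; lra.
exact: step.
Qed.

Definition separated x :=
  [exists v : V, pos one (bit x) 0 h v != pos one (bit x) 0 h (v + inZp 1)].

Let separated_le_alive : avg (fun x => (separated x)%:R) <= alive h.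
Proof.
rewrite /alive -avg_sum; apply: le_avg => x.
case sx: (separated x); last by apply: sumr_ge0 => v _.
have /existsP[v neq] := sx.
by rewrite (bigD1 v) //= /P eq_sym neq lerDl; apply: sumr_ge0 => u _.
Qed.

Lemma separated_harmonic :
  h%:R * avg (fun x => (separated x)%:R) <= 2 * w%:R ^+ 2 :> R.
Proof. by apply: le_trans alive_harmonic; rewrite ler_wpM2l. Qed.

Lemma separated_geometric :
  avg (fun x => (separated x)%:R) <= w%:R ^+ 2 * (1 - (w%:R ^+ 2)^-1) ^+ h :> R.
Proof. exact: le_trans separated_le_alive alive_geometric. Qed.

End Cycle.

(** * Algorithms for the winding function *)

Section WindingAlgorithm.
Context (R : realType) (n w' m : nat).
Let w := w'.+1.
Let h := (w * (2 * m).+1)%N.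
Local Notation V := 'I_w'.+1.
Hypothesis hn : (h * w <= n)%N.
Implicit Types (x : cube n).

Let one : nat -> V := fun=> inZp 1.

Let alg lazy := uniform_algorithm R
  [seq winding_tree m n lazy v | v <- enum [set: V]].

Let V0 : (0 < #|[set: V]|)%N. Proof. by rewrite cardsT card_ord. Qed.

Let separatedE x : separated w' h x = ~~ coalesced w' m x.
Proof. by rewrite /coalesced negb_forall. Qed.

Let hn0 (v : V) : (vtx 0 v < n)%N.
Proof. by apply: leq_trans hn; apply: vtx_lt. Qed.

Let max_read_prob_ge lazy : w%:R^-1 <= max_read_prob (alg lazy).
Proof.
apply: (@max_read_prob_layer _ _ _ 0 _ _ _ hn0) => // v x _.
by exists v; apply: winding_tree_reads_first.
Qed.

(** Each of the two rounds reads a given bit with probability at most [1 / w]: the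
    second one also follows a rotation equivariant trajectory. *)
Let max_read_prob_le lazy : max_read_prob (alg lazy) <=
  2 / w%:R + (~~ lazy)%:R * avg (fun x => (separated w' h x)%:R).
Proof.
have sep0 : 0 <= avg (fun x => (separated w' h x)%:R) :> R by apply: avg_ge0.
rewrite /max_read_prob; apply: bigmax_le => [|i _].
  by apply: addr_ge0; [apply: divr_ge0|apply: mulr_ge0].
rewrite read_prob_uniform // cardsT card_ord.
under eq_bigr => v _ do rewrite cube_meanE.
set t := (i %/ w)%N; pose u : V := inord (i %% w).
have iE : i = vtx t u :> nat by rewrite /vtx inordK ?ltn_pmod // -divn_eq.
pose P x k v := pos one (bit x) 0 k v.
pose first x := \sum_v (P x t v == u)%:R : R.
pose second x := \sum_v (P x t (P x h v) == u)%:R : R.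
have le1 v x : (tree_reads (winding_tree m n lazy v) x i)%:R <=
    (t < h)%N%:R * ((P x t v == u)%:R + (P x t (P x h v) == u)%:R)
    + (~~ lazy)%:R * (separated w' h x)%:R :> R.
  case rd: (tree_reads _ _ _); last by rewrite addr_ge0 ?mulr_ge0 ?addr_ge0.
  have := winding_tree_reads iE rd; rewrite separatedE.
  case/orP => [/andP[-> /orP[->|->]]|/andP[-> ->]].
  - by rewrite mul1r -addrA lerDl addr_ge0 ?mulr_ge0.
  - by rewrite mul1r -addrA addrCA lerDl addr_ge0 ?mulr_ge0.
  by rewrite mul1r lerDr mulr_ge0 ?addr_ge0.
have le2 x : \sum_(v in [set: V]) (tree_reads (winding_tree m n lazy v) x i)%:R <=
    (t < h)%N%:R * (first x + second x)
    + w%:R * ((~~ lazy)%:R * (separated w' h x)%:R) :> R.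
  apply: le_trans (ler_sum _ (fun v _ => le1 v x)) _.
  rewrite [leLHS](eq_bigl predT) => [|v]; last by rewrite inE.
  rewrite big_split -mulr_sumr big_split sumr_const card_ord -[_ * _ *+ _]mulr_natl.
  exact: lexx.
rewrite -avg_sum; apply: le_trans (ler_wpM2r _ (le_avg le2)) _; first by rewrite invr_ge0.
rewrite avgD !avgZ avgD mulrDl [w%:R * _]mulrC mulfK ?pnatr_eq0 // lerD2r.
rewrite ler_wpM2r ?invr_ge0 //.
case: ltnP => th; last by rewrite mul0r.
have rot c x v : pos one (bit (rotate h c x)) 0 t v + c = pos one (bit x) 0 t (v + c).
  by apply: (pos_rotate hn); apply: ltnW.
rewrite mul1r (avg_visits _ hn rot) (avg_visits _ hn (p := fun x v => P x t (P x h v))) //.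
by move=> c x v; rewrite /P rot (pos_rotate hn).
Qed.

(** Two rounds cost [2 / w], and [b] bounds the probability of a full reading. *)
Theorem winding_zero_error (b : R) :
  w%:R ^+ 2 * (1 - (w%:R ^+ 2)^-1) ^+ h <= b ->
  exists f A, [/\ balanced f, monotone_function f, always_correct A f,
    w%:R^-1 <= max_read_prob (A : randomized_algorithm R n)
    & max_read_prob A <= 2 / w%:R + b].
Proof.
move=> hb; exists (winding_function w' m (n := n)), (alg false); split => //.
- exact: winding_function_balanced.
- exact: winding_function_monotone.
- by move=> x; apply: prob_correct_eq1 => // v _; apply: winding_tree_correct.
- apply: le_trans (max_read_prob_le false) _; rewrite mul1r lerD2l.
  exact: le_trans (separated_geometric R hn) hb.
Qed.

Theorem winding_small_error (eps : R) : 0 < eps -> 2 * w%:R ^+ 2 <= h%:R * eps ->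
  exists f A, [/\ balanced f, monotone_function f, mostly_correct eps A f,
    w%:R^-1 <= max_read_prob (A : randomized_algorithm R n)
    & max_read_prob A <= 2 / w%:R].
Proof.
move=> e0 he; exists (winding_function w' m (n := n)), (alg true); split => //.
- exact: winding_function_balanced.
- exact: winding_function_monotone.
- rewrite /mostly_correct.
  have sub x : 1 - (separated w' h x)%:R <=
    ((1 - eps <= prob_correct (alg true) (winding_function w' m (n := n)) x)%R)%:R :> R.
    rewrite separatedE; case: (boolP (coalesced w' m x)) => [cx|_] /=; last by rewrite subrr.
    rewrite prob_correct_eq1 // => [|v _]; last by apply: winding_tree_correct; rewrite cx.
    by rewrite gerBl (ltW e0) subr0.
  rewrite cube_probE; apply: le_trans (le_avg sub).
  rewrite avgB avg_cst ?cube_gt0 // lerD2l lerN2.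
  have h0 : 0 < h%:R :> R by rewrite ltr0n.
  by rewrite -(ler_pM2l h0); apply: le_trans (separated_harmonic R hn) he.
- by apply: le_trans (max_read_prob_le true) _; rewrite mul0r addr0.
Qed.

End WindingAlgorithm.
(** * Asymptotics *)

Local Open Scope classical_set_scope.

Section Asymptotics.
Context (R : realType).

Lemma bigTheta_of_bounds (f g : nat -> R) (a b : R) : 0 < a -> 0 < b ->
  (\forall n \near \oo, 0 <= g n /\ a * g n <= f n <= b * g n) ->
  f =Theta_\oo g.
Proof.
move=> a0 b0 fg; rewrite /the_bigTheta insubdK //; apply/asboolP.
exists (a, b); first by rewrite /= a0 b0.
apply: filterS fg => n [g0 /andP[lo hi]].
have f0 : 0 <= f n by apply: le_trans lo; rewrite mulr_ge0 // ltW.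
by rewrite /= !ger0_norm.
Qed.

(** The width of the layers is chosen as the inverse of the target rate. *)
Lemma theta_of_widths (P : forall n, boolean_function n -> randomized_algorithm R n -> Prop)
    (C kappa : R) (rate : nat -> R) : 0 < C -> 0 < kappa ->
  (\forall n \near \oo, 0 < rate n /\ kappa * rate n <= 1) ->
  (\forall n \near \oo, forall w', w'.+1%:R * (kappa * rate n) <= 1 ->
     exists f A, [/\ P n f A, w'.+1%:R^-1 <= max_read_prob A
                   & max_read_prob A <= C / w'.+1%:R]) ->
  exists (f : forall n, boolean_function n) (A : forall n, randomized_algorithm R n),
    (\forall n \near \oo, P n (f n) (A n)) /\
    (fun n => max_read_prob (A n)) =Theta_\oo rate.
Proof.
move=> C0 k0 rate_small build.
pose good n (fA : boolean_function n * randomized_algorithm R n) :=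
  P n fA.1 fA.2 /\
  kappa * rate n <= max_read_prob fA.2 <= 2 * C * kappa * rate n.
have ex n : exists fA, (exists fA', good n fA') -> good n fA.
  have [[fA' h]|h] := pselect (exists fA', good n fA'); first by exists fA'.
  by exists (fun=> true, uniform_algorithm R [::]).
pose fA n := projT1 (cid (ex n)).
have fAP : \forall n \near \oo, good n (fA n) /\ 0 < rate n.
  apply: filterS2 rate_small build => n [r0 kr1] build; split => //.
  rewrite /fA; case: cid => /= c; apply.
  have kr0 : 0 < kappa * rate n by rewrite mulr_gt0.
  pose w := Num.truncn (kappa * rate n)^-1.
  have /truncn_itv/andP[wle ltw] : 0 <= (kappa * rate n)^-1 by rewrite invr_ge0 ltW.
  have w0 : (0 < w)%N by rewrite truncn_gt0 invf_ge1.
  rewrite -/w in wle ltw; rewrite -(prednK w0) in wle ltw *.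
  set w' := w.-1 in wle ltw *; have w'0 : 0 < w'.+1%:R :> R by rewrite ltr0n.
  have wk : w'.+1%:R * (kappa * rate n) <= 1 by rewrite -ler_pdivlMr // mul1r.
  have [f [A [Pf lo hi]]] := build _ wk.
  exists (f, A); split => //=; apply/andP; split.
    by apply: le_trans lo; rewrite -[leRHS]mul1r ler_pdivlMr // mulrC.
  apply: le_trans hi _; rewrite ler_pdivrMr //.
  have : 1 <= w'.+2%:R * (kappa * rate n) by rewrite -ler_pdivrMr // mul1r ltW.
  have : 1 <= w'.+1%:R :> R by rewrite ler1n.
  rewrite -[w'.+2%:R]natr1 => w1 wkr.
  have wkr2 : 1 <= 2 * w'.+1%:R * (kappa * rate n) by nra.
  have := ler_wpM2l (ltW C0) wkr2; lra.
exists (fun n => (fA n).1), (fun n => (fA n).2); split.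
  by apply: filterS fAP => n [[]].
apply: (@bigTheta_of_bounds _ _ kappa (2 * C * kappa)) => //; first by rewrite !mulr_gt0.
by apply: filterS fAP => n [[_ b] /ltW r0].
Qed.

Lemma near_ge (c : R) : \forall n \near \oo, c <= n%:R.
Proof. exact: nbhs_infty_ger. Qed.

Lemma powR_invn (x : R) k : 0 < x -> (0 < k)%N -> (x `^ (- k%:R^-1)) ^+ k = x^-1.
Proof.
move=> x0 k0; rewrite -powR_mulrn ?powR_ge0 // -powRrM mulNr mulVf ?pnatr_eq0 -?lt0n //.
by rewrite powR_inv1 // ltW.
Qed.

Lemma near_powR_small k (c : R) : (0 < k)%N -> 0 < c ->
  \forall n \near \oo, c * n%:R `^ (- k%:R^-1) <= 1.
Proof.
move=> k0 c0; apply: filterS2 (near_ge 1) (near_ge (c ^+ k)) => n n1 nc.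
have n0 : 0 < n%:R :> R by apply: lt_le_trans n1.
rewrite -(@expr_le1 _ k) ?mulr_ge0 ?powR_ge0 ?(ltW c0) //.
by rewrite exprMn powR_invn // ler_pdivrMr // mul1r.
Qed.

Lemma ln_le_powR (x : R) k : 0 < x -> (0 < k)%N ->
  ln x * x `^ (- k%:R^-1) <= k%:R.
Proof.
move=> x0 k0; have k0R : 0 < k%:R :> R by rewrite ltr0n.
have y0 : 0 < x `^ k%:R^-1 by apply: powR_gt0.
have -> : ln x = k%:R * ln (x `^ k%:R^-1).
  by rewrite ln_powR mulrA divff ?mul1r // lt0r_neq0.
rewrite powRN -mulrA -[leRHS]mulr1 ler_pM2l // ler_pdivrMr // mul1r.
exact/ltW/ln_sublinear.
Qed.

Lemma ln2_ge : 2^-1 <= ln 2 :> R.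
Proof.
rewrite -[leLHS]expRK ler_ln ?posrE ?expR_gt0 //.
rewrite -lef_pV2 ?posrE ?expR_gt0 // -expRN.
by apply: le_trans (expR_ge1Dx _); lra.
Qed.

Lemma ln_ge1 n : (4 <= n)%N -> 1 <= ln n%:R :> R.
Proof.
move=> n4; have n0 : 0 < n%:R :> R by rewrite ltr0n (leq_trans _ n4).
apply: (@le_trans _ _ (ln 4)); last by rewrite ler_ln ?posrE // ler_nat.
have -> : 4 = 2 ^+ 2 :> R by rewrite expr2; lra.
by rewrite lnXn // mulr2n; have := ln2_ge; lra.
Qed.

Lemma binary_digits n : (4 <= n)%N ->
  exists l, [/\ (0 < l)%N, (n < 2 ^ l)%N & l%:R <= 3 * ln n%:R :> R].
Proof.
move=> n4; have n0 : (0 < n)%N by apply: leq_trans n4.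
exists (trunc_log 2 n).+1; split => //; first exact: trunc_log_ltn.
have : (2 ^ trunc_log 2 n)%:R <= n%:R :> R by rewrite ler_nat trunc_logP.
rewrite -ler_ln ?posrE ?ltr0n ?expn_gt0 // natrX lnXn // -[ln _ *+ _]mulr_natr.
rewrite -[(trunc_log 2 n).+1%:R]natr1 => tL.
have t0 : 0 <= (trunc_log 2 n)%:R :> R by [].
have := ln_ge1 n4; have := ler_wpM2r t0 ln2_ge; lra.
Qed.

(** The layers number [8 w l + 1] where [l] is of order [log n]: with
    [w = n^(1/2) / (6 (log n)^(1/2))] they fit in [n] bits. *)
Theorem zero_error_rate :
  exists (f : forall n : nat, boolean_function n)
    (A : forall n : nat, randomized_algorithm R n),
    (\forall n \near \oo, balanced (f n) /\ always_correct (A n) (f n)) /\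
    (fun n => max_read_prob (A n)) =Theta_\oo
      (fun n => n%:R `^ (- 2^-1) * Num.sqrt (ln n%:R)).
Proof.
apply: (@theta_of_widths (fun n f A => balanced f /\ always_correct A f) 44 6) => //.
  have c0 : 0 < 72 :> R by [].
  apply: filterS2 (near_ge (4 : R)) (near_powR_small (isT : (0 < 2)%N) c0) => n.
  rewrite ler_nat => n4; set p := _ `^ _ => p72.
  have n0 : 0 < n%:R :> R by rewrite ltr0n (leq_trans _ n4).
  have L1 := ln_ge1 n4; have p0 : 0 < p by apply: powR_gt0.
  have L0 : 0 < ln n%:R :> R by apply: lt_le_trans L1.
  split; first by rewrite mulr_gt0 // sqrtr_gt0.
  have Lp : ln n%:R * p <= 2 by apply: (ln_le_powR (k := 2)).
  rewrite -(@expr_le1 _ 2) //; last by rewrite !mulr_ge0 ?sqrtr_ge0 // ltW.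
  by rewrite !exprMn sqr_sqrtr ?(ltW L0) //; nra.
apply: filterS (near_ge (4 : R)) => n; rewrite ler_nat => n4 w'.
set w := w'.+1; set p := _ `^ _ => wp.
have n0 : 0 < n%:R :> R by rewrite ltr0n (leq_trans _ n4).
have L1 := ln_ge1 n4; have p0 : 0 < p by apply: powR_gt0.
have p2 : p ^+ 2 = n%:R^-1 by apply: powR_invn.
have L0 : 0 < ln n%:R :> R by apply: lt_le_trans L1.
have w0 : 0 < w%:R :> R by rewrite ltr0n.
have wn : 36 * w%:R ^+ 2 * ln n%:R <= n%:R :> R.
  move: wp; rewrite -(@expr_le1 _ 2) //; last by rewrite !mulr_ge0 ?sqrtr_ge0 // ltW.
  rewrite !exprMn sqr_sqrtr ?(ltW L0) // p2 -(ler_pM2r n0) mul1r.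
  by apply: le_trans; rewrite le_eqVlt; apply/orP; left; apply/eqP; field; apply: lt0r_neq0.
have [l [l0 nl lL]] := binary_digits n4.
have l1 : 1 <= l%:R :> R by rewrite ler1n.
have w1 : 1 <= w%:R :> R by rewrite ler1n.
have wl : (w <= 2 ^ l)%N.
  by apply: leq_trans (ltnW nl); rewrite -(ler_nat R); nra.
have hn : ((2 * (4 * w * l)).+1 * w <= n)%N.
  rewrite -(ler_nat R) natrM -natr1 !natrM; apply: le_trans wn.
  have : (8 * (w%:R * l%:R) + 1) * w%:R <= 9 * (w%:R * l%:R) * w%:R :> R.
    by rewrite ler_pM2r //; nra.
  have : w%:R ^+ 2 * l%:R <= w%:R ^+ 2 * (3 * ln n%:R) :> R.
    by rewrite ler_pM2l // exprn_gt0.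
  nra.
have [f [A [bf cA lo hi]]] := zero_error_construction R l0 wl hn.
by exists f, A.
Qed.

(** The layers number [K w + 1], where [K] is at least [4 / eps]. *)
Theorem small_error_rate (eps : R) :
  0 < eps ->
  exists (f : forall n : nat, boolean_function n)
    (A : forall n : nat, randomized_algorithm R n),
    (\forall n \near \oo, balanced (f n) /\ mostly_correct eps (A n) (f n)) /\
    (fun n => max_read_prob (A n)) =Theta_\oo (fun n => n%:R `^ (- 2^-1)).
Proof.
move=> e0; pose K := (Num.truncn (4 / eps)).+1.
have K4 : 4 <= K%:R * eps.
  by rewrite -ler_pdivrMr // ltW // truncnS_gt.
have K1 : 1 <= K%:R :> R by rewrite ler1n.
have K0 : 0 < K%:R :> R by rewrite ltr0n.
apply: (@theta_of_widths (fun n f A => balanced f /\ mostly_correct eps A f)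
  1 (2 * K%:R)) => //; first by rewrite mulr_gt0.
  have c0 : 0 < 2 * K%:R :> R by rewrite mulr_gt0.
  apply: filterS2 (near_ge (1 : R)) (near_powR_small (isT : (0 < 2)%N) c0) => n n1 np.
  by split=> //; apply: powR_gt0; apply: lt_le_trans n1.
apply: filterS (near_ge (1 : R)) => n n1 w'; set w := w'.+1; set p := _ `^ _ => wp.
have n0 : 0 < n%:R :> R by apply: lt_le_trans n1.
have p0 : 0 < p by apply: powR_gt0.
have p2 : p ^+ 2 = n%:R^-1 by apply: powR_invn.
have w1 : 1 <= w%:R :> R by rewrite ler1n.
have w0 : 0 < w%:R :> R by rewrite ltr0n.
have wn : 4 * K%:R ^+ 2 * w%:R ^+ 2 <= n%:R :> R.
  move: wp; rewrite -(@expr_le1 _ 2) //; last by rewrite !mulr_ge0 // ltW.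
  rewrite !exprMn p2 -(ler_pM2r n0) mul1r.
  by apply: le_trans; rewrite le_eqVlt; apply/orP; left; apply/eqP; field; apply: lt0r_neq0.
have hn : ((K * w).+1 * w <= n)%N.
  rewrite -(ler_nat R) natrM -natr1 natrM; apply: le_trans wn.
  have : (K%:R * w%:R + 1) * w%:R <= 2 * (K%:R * w%:R) * w%:R :> R.
    by rewrite ler_pM2r //; nra.
  have : K%:R * w%:R ^+ 2 <= K%:R ^+ 2 * w%:R ^+ 2 :> R.
    by rewrite ler_pM2r ?exprn_gt0 // expr2 ler_peMr // ltW.
  nra.
have [f [A [bf cA lo hi]]] := small_error_construction e0 (isT : (0 < K)%N) K4 hn.
by exists f, A; rewrite mul1r.
Qed.

(** Layers numbering [w (4 l w + 1)] would allow a width of order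
    [(n / log n)^(1/3)]; the smaller width [n^(1/3) / (3 log n)] is the one that
    gives the stated rate. *)
Theorem monotone_zero_error_rate :
  exists (f : forall n : nat, boolean_function n)
    (A : forall n : nat, randomized_algorithm R n),
    (\forall n \near \oo, [/\ balanced (f n), monotone_function (f n)
                            & always_correct (A n) (f n)]) /\
    (fun n => max_read_prob (A n)) =Theta_\oo
      (fun n => n%:R `^ (- 3^-1) * ln n%:R).
Proof.
have layers a b : (b ^ 2 * (3 * a) <= b * (2 * (2 * a * b)).+1)%N.
  by rewrite -mulnn -mulnA leq_mul2l; apply/orP; right; lia.
apply: (@theta_of_widths
  (fun n f A => [/\ balanced f, monotone_function f & always_correct A f]) 3 3) => //.
  have c0 : 0 < 18 :> R by [].
  apply: filterS2 (near_ge (4 : R)) (near_powR_small (isT : (0 < 6)%N) c0) => n.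
  rewrite ler_nat => n4; set q := _ `^ _ => q18.
  have n0 : 0 < n%:R :> R by rewrite ltr0n (leq_trans _ n4).
  have L1 := ln_ge1 n4; have q0 : 0 < q by apply: powR_gt0.
  have L0 : 0 < ln n%:R :> R by apply: lt_le_trans L1.
  split; first by rewrite mulr_gt0 // powR_gt0.
  have Lq : ln n%:R * q <= 6 by apply: (ln_le_powR (k := 6)).
  have -> : n%:R `^ (- 3^-1) = q ^+ 2.
    by rewrite -powR_mulrn ?powR_ge0 // -powRrM; congr (_ `^ _); lra.
  nra.
apply: filterS (near_ge (4 : R)) => n; rewrite ler_nat => n4 w'.
set w := w'.+1; set p := _ `^ _ => wp.
have n0 : 0 < n%:R :> R by rewrite ltr0n (leq_trans _ n4).
have L1 := ln_ge1 n4; have p0 : 0 < p by apply: powR_gt0.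
have p3 : p ^+ 3 = n%:R^-1 by apply: powR_invn.
have L0 : 0 < ln n%:R :> R by apply: lt_le_trans L1.
have w0 : 0 < w%:R :> R by rewrite ltr0n.
have w1 : 1 <= w%:R :> R by rewrite ler1n.
have wn : 27 * w%:R ^+ 3 * ln n%:R <= n%:R :> R.
  have : 27 * w%:R ^+ 3 * ln n%:R ^+ 3 <= n%:R :> R.
    move: wp; rewrite -(@expr_le1 _ 3) //; last by rewrite !mulr_ge0 // ltW.
    rewrite !exprMn p3 -(ler_pM2r n0) mul1r.
    by apply: le_trans; rewrite le_eqVlt; apply/orP; left; apply/eqP; field; apply: lt0r_neq0.
  apply: le_trans; rewrite ler_pM2l ?mulr_gt0 ?exprn_gt0 //.
  by rewrite -[leLHS]expr1 ler_weXn2l.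
have [l [l0 nl lL]] := binary_digits n4.
have l1 : 1 <= l%:R :> R by rewrite ler1n.
have w3 : w%:R <= w%:R ^+ 3 :> R by rewrite -[leLHS]expr1 ler_weXn2l.
have wl : (w <= 2 ^ l)%N.
  by apply: leq_trans (ltnW nl); rewrite -(ler_nat R); nra.
pose m := (2 * l * w)%N; pose h := (w * (2 * m).+1)%N.
have hn : (h * w <= n)%N.
  rewrite -(ler_nat R) /h /m !natrM -natr1 !natrM; apply: le_trans wn.
  have e1 : 2 * (2 * l%:R * w%:R) + 1 <= 5 * (l%:R * w%:R) :> R by nra.
  have e2 : l%:R * w%:R ^+ 3 <= 3 * ln n%:R * w%:R ^+ 3 :> R.
    by rewrite ler_pM2r // exprn_gt0.
  have e3 : w%:R * w%:R * (2 * (2 * l%:R * w%:R) + 1) <=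
      w%:R * w%:R * (5 * (l%:R * w%:R)) :> R by rewrite ler_pM2l // mulr_gt0.
  have : 0 < w%:R ^+ 3 * ln n%:R :> R by rewrite mulr_gt0 // exprn_gt0.
  lra.
have wb : w%:R ^+ 2 * (1 - (w%:R ^+ 2)^-1) ^+ h <= w%:R^-1 :> R.
  have q0 : 0 <= 1 - (w%:R ^+ 2)^-1 :> R.
    by rewrite subr_ge0 invf_le1 ?exprn_gt0 // -natrX ler1n expn_gt0.
  have q1 : 1 - (w%:R ^+ 2)^-1 <= 1 :> R by rewrite gerBl invr_ge0 exprn_ge0 // ltW.
  have hw : (w ^ 2 * (3 * l) <= h)%N := layers l w.
  apply: le_trans (ler_wpM2l (exprn_ge0 2 (ltW w0)) (ler_wiXn2l q0 q1 hw)) _.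
  rewrite exprM -natrX.
  have half : (1 - ((w ^ 2)%:R)^-1) ^+ (w ^ 2) <= 2^-1 :> R.
    by apply: pow_1Binv_le; rewrite expn_gt0.
  have half3 : ((1 - ((w ^ 2)%:R)^-1) ^+ (w ^ 2)) ^+ (3 * l) <= (w%:R ^+ 3)^-1 :> R.
    apply: le_trans (lerXn2r _ _ _ half) _.
    - by rewrite nnegrE natrX exprn_ge0.
    - by rewrite nnegrE invr_ge0.
    rewrite exprVn lef_pV2 ?posrE ?exprn_gt0 // mulnC exprM.
    by rewrite lerXn2r ?nnegrE ?exprn_ge0 ?(ltW w0) // -natrX ler_nat.
  apply: le_trans (ler_wpM2l _ half3) _; first by rewrite ler0n.
  by rewrite natrX le_eqVlt; apply/orP; left; apply/eqP; field; apply: lt0r_neq0.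
have [f [A [bf mf cA lo hi]]] := winding_zero_error hn wb.
exists f, A; split => //; apply: le_trans hi _.
by rewrite -/w; lra.
Qed.

(** The layers number [w (2 K w + 1)], where [K] is at least [1 / eps]. *)
Theorem monotone_small_error_rate (eps : R) :
  0 < eps ->
  exists (f : forall n : nat, boolean_function n)
    (A : forall n : nat, randomized_algorithm R n),
    (\forall n \near \oo, [/\ balanced (f n), monotone_function (f n)
                            & mostly_correct eps (A n) (f n)]) /\
    (fun n => max_read_prob (A n)) =Theta_\oo (fun n => n%:R `^ (- 3^-1)).
Proof.
move=> e0; pose K := (Num.truncn (1 / eps)).+1.
have K1e : 1 <= K%:R * eps.
  by rewrite -ler_pdivrMr // ltW // truncnS_gt.
have K1 : 1 <= K%:R :> R by rewrite ler1n.
have K0 : 0 < K%:R :> R by rewrite ltr0n.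
apply: (@theta_of_widths
  (fun n f A => [/\ balanced f, monotone_function f & mostly_correct eps A f])
  2 (3 * K%:R)) => //; first by rewrite mulr_gt0.
  have c0 : 0 < 3 * K%:R :> R by rewrite mulr_gt0.
  apply: filterS2 (near_ge (1 : R)) (near_powR_small (isT : (0 < 3)%N) c0) => n n1 np.
  by split=> //; apply: powR_gt0; apply: lt_le_trans n1.
apply: filterS (near_ge (1 : R)) => n n1 w'; set w := w'.+1; set p := _ `^ _ => wp.
have n0 : 0 < n%:R :> R by apply: lt_le_trans n1.
have p0 : 0 < p by apply: powR_gt0.
have p3 : p ^+ 3 = n%:R^-1 by apply: powR_invn.
have w1 : 1 <= w%:R :> R by rewrite ler1n.
have w0 : 0 < w%:R :> R by rewrite ltr0n.
have wn : 27 * K%:R ^+ 3 * w%:R ^+ 3 <= n%:R :> R.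
  move: wp; rewrite -(@expr_le1 _ 3) //; last by rewrite !mulr_ge0 // ltW.
  rewrite !exprMn p3 -(ler_pM2r n0) mul1r.
  by apply: le_trans; rewrite le_eqVlt; apply/orP; left; apply/eqP; field; apply: lt0r_neq0.
pose m := (K * w)%N; pose h := (w * (2 * m).+1)%N.
have hn : (h * w <= n)%N.
  rewrite -(ler_nat R) /h /m !natrM -natr1 !natrM; apply: le_trans wn.
  have e1 : 2 * (K%:R * w%:R) + 1 <= 3 * (K%:R * w%:R) :> R by nra.
  have e2 : K%:R * w%:R ^+ 3 <= K%:R ^+ 3 * w%:R ^+ 3 :> R.
    by rewrite ler_pM2r ?exprn_gt0 // -[leLHS]expr1 ler_weXn2l.
  have e3 : w%:R * w%:R * (2 * (K%:R * w%:R) + 1) <=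
      w%:R * w%:R * (3 * (K%:R * w%:R)) :> R by rewrite ler_pM2l // mulr_gt0.
  have : 0 < K%:R ^+ 3 * w%:R ^+ 3 :> R by rewrite mulr_gt0 // exprn_gt0.
  lra.
have he : 2 * w%:R ^+ 2 <= h%:R * eps.
  have -> : h%:R = w%:R * (2 * (K%:R * w%:R) + 1) :> R.
    by rewrite /h natrM -[(2 * m).+1]addn1 natrD !natrM.
  have : w%:R ^+ 2 * 1 <= w%:R ^+ 2 * (K%:R * eps) by rewrite ler_pM2l // exprn_gt0.
  have : 0 < w%:R * eps by rewrite mulr_gt0.
  lra.
have [f [A [bf mf cA lo hi]]] := @winding_small_error R n w' m hn eps e0 he.
by exists f, A.
Qed.

End Asymptotics.

Theorem theorem1 (R : realType) :
  [/\ exists (f : forall n : nat, boolean_function n)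
        (A : forall n : nat, randomized_algorithm R n),
        (\forall n \near \oo, balanced (f n) /\ always_correct (A n) (f n)) /\
        (fun n => max_read_prob (A n)) =Theta_\oo
          (fun n => n%:R `^ (- 2^-1) * Num.sqrt (ln n%:R)),
      forall eps : R, 0 < eps ->
        exists (f : forall n : nat, boolean_function n)
          (A : forall n : nat, randomized_algorithm R n),
          (\forall n \near \oo,
             balanced (f n) /\ mostly_correct eps (A n) (f n)) /\
          (fun n => max_read_prob (A n)) =Theta_\oo
            (fun n => n%:R `^ (- 2^-1)),
      exists (f : forall n : nat, boolean_function n)
        (A : forall n : nat, randomized_algorithm R n),
        (\forall n \near \oo,
           [/\ balanced (f n), monotone_function (f n)
             & always_correct (A n) (f n)]) /\
        (fun n => max_read_prob (A n)) =Theta_\oo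
          (fun n => n%:R `^ (- 3^-1) * ln n%:R)
    & forall eps : R, 0 < eps ->
        exists (f : forall n : nat, boolean_function n)
          (A : forall n : nat, randomized_algorithm R n),
          (\forall n \near \oo,
             [/\ balanced (f n), monotone_function (f n)
               & mostly_correct eps (A n) (f n)]) /\
          (fun n => max_read_prob (A n)) =Theta_\oo
            (fun n => n%:R `^ (- 3^-1))].
Proof.
split.
- exact: zero_error_rate.
- exact: small_error_rate.
- exact: monotone_zero_error_rate.
- exact: monotone_small_error_rate.
Qed.
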